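(* Let $E$ be a row-finite directed graph. The $C^*$-algebra $C^*_{\min}(E)$ is simple if and only if $E$ is cofinal.
   Context: A directed graph $E$ consists of countable sets $E^0$ (vertices) and $E^1$ (edges) and maps $r,s : E^1 \to E^0$; the edge $e$ points from $s(e)$ to $r(e)$. Write $vE^1 = r^{-1}(v)$. $E$ is row-finite if $vE^1$ is finite for every $v \in E^0$. A path is a sequence $\lambda = \lambda_1 \cdots \lambda_n$ of edges with $s(\lambda_i) = r(\lambda_{i+1})$ for $i<n$; $r(\lambda) = r(\lambda_1)$, $s(\lambda) = s(\lambda_n)$, $|\lambda| = n$ (vertices are paths of length $0$). $E^*$ is the set of paths, and $vE^*w$ the set of paths with range $v$ and source $w$. For elements $t_e$ indexed by edges, $t_\lambda := t_{\lambda_1}\cdots t_{\lambda_n}$. $E^\infty$ is the set of infinite paths $x = x_1x_2\cdots$ ($x_i \in E^1$, $s(x_i) = r(x_{i+1})$), and $E^{\le\infty} = E^\infty \cup \{\alpha \in E^* : s(\alpha)E^1 = \emptyset\}$. For $x \in E^{\le \infty}$, $x(n)$ ($0 \le n \le |x|$) is the $n$th vertex on $x$: $x(0) = r(x)$ and $x(n) = s(x_n)$. $E$ is cofinal if for every $v \in E^0$ and every $x \in E^{\le\infty}$ there is an $n$ with $vE^*x(n) \ne \emptyset$. A cycle is a path $\mu = \mu_1 \cdots \mu_{|\mu|}$ with $|\mu| \ge 1$, $r(\mu) = s(\mu)$ and $s(\mu_i) \ne s(\mu_j)$ for $i<j$. It has no entrance in $E$ if $e \in E^1$ and $r(e) =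 r(\mu_i)$ imply $e = \mu_i$, for all $i$. For a cycle $\mu$, $[\mu]$ is the set of its cyclic permutations and $[\mu]^1 = \{\mu_i : 1 \le i \le |\mu|\}$. $C(E)$ is the set of all $[\mu]$ where $\mu$ is a cycle with no entrance in $E$, and $C(E)^1 = \bigcup_{C \in C(E)} C^1$. A cutting set for $E$ is a subset $X \subset C(E)^1$ such that $X \cap C^1$ is a singleton for each $C \in C(E)$. A Toeplitz-Cuntz-Krieger $E$-family in a $C^*$-algebra consists of elements $\{p_v : v \in E^0\}$, $\{s_e : e \in E^1\}$ such that (T1) the $p_v$ are mutually orthogonal projections; (T2) $s_e^* s_e = p_{s(e)}$ for all $e \in E^1$; (T3) $p_v \ge \sum_{e \in F} s_e s_e^*$ for all $v \in E^0$ and finite $F \subset r^{-1}(v)$. It is a Cuntz-Krieger $E$-family if moreover (CK) $p_v = \sum_{r(e)=v} s_e s_e^*$ whenever $0 < |r^{-1}(v)| < \infty$. A normalised reduced Cuntz-Krieger $E$-family is a Cuntz-Krieger $E$-family such that $s_\mu = p_{r(\mu)}$ for each cycle $\mu$ with no entrance in $E$. $C^*_{\min}(E)$ denotes the co-universal $C^*$-algebra of $E$ (existing for row-finite $E$, and unique up to isomorphism): it is generated by a normalised reduced Cuntz-Krieger $E$-family $\{p^m_v : v \in E^0\}$, $\{s^m_e : e \in E^1\}$ such that (a) every $p^m_v$ is nonzero; (b) given any Toeplitz-Cuntz-Krieger $E$-family $\{q_v\}, \{t_e\}$ in a $C^*$-algebra with each $q_v \ne 0$ and any cutting set $X$ for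 $E$, there are a function $\kappa : X \to \mathbb{T}$ and a homomorphism $\psi_{q,t} : C^*(\{q_v, t_e : v \in E^0, e \in E^1\}) \to C^*_{\min}(E)$ with $\psi_{q,t}(q_v) = p^m_v$ for all $v \in E^0$, $\psi_{q,t}(t_e) = s^m_e$ for all $e \in E^1 \setminus X$, and $\psi_{q,t}(t_x) = \kappa(x) s^m_x$ for all $x \in X$. A $C^*$-algebra is simple if it has no closed two-sided ideals other than $\{0\}$ and itself. *)

(* Defs.v *)
From HB Require Import structures.
From mathcomp Require Import all_boot all_order all_algebra.
From mathcomp Require Import all_classical all_reals all_analysis.
From mathcomp Require Import complex.

Set Implicit Arguments.
Unset Strict Implicit.
Unset Printing Implicit Defensive.

Import Order.TTheory GRing.Theory Num.Theory.
Import numFieldNormedType.Exports.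

Local Open Scope classical_set_scope.
Local Open Scope ring_scope.

(* [countType] means countable (finite, possibly empty, or infinite); the edge
   e points from [src e] to [rng e]. *)
Record digraph := Digraph {
  vertex : countType;
  edge : countType;
  rng : edge -> vertex;
  src : edge -> vertex }.

Section Graph.
Variable E : digraph.
Implicit Types (v w : vertex E) (e f : edge E) (l mu : seq (edge E)).

Definition edges_to v : set (edge E) := [set e | rng e = v].

Definition row_finite : Prop := forall v, finite_set (edges_to v).

Definition composable e f : bool := src e == rng f.

(* A finite path is encoded by its range v and its list of edges l, so that
   (v, [::]) is the path of length 0 at v. *)
Definition is_path v l : bool :=
  if l is e :: l' then (rng e == v) && path composable e l' else true.

Definition path_src v l : vertex E := last v (map (@src E) l).

(* v E^* w is nonempty *)
Definition connects v w : Prop := exists2 l, is_path v l & path_src v l = w.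

(* Candidates for elements of E^{<= infty}; in [InfPath x] the edge written
   x_{i+1} on paper is [x i]. *)
Variant bpath :=
  | FinPath of vertex E & seq (edge E)
  | InfPath of nat -> edge E.

(* x belongs to E^{<= infty} *)
Definition is_bpath (x : bpath) : Prop :=
  match x with
  | FinPath v l => is_path v l /\ edges_to (path_src v l) = set0
  | InfPath y => forall i, composable (y i) (y i.+1)
  end.

(* n <= |x| *)
Definition le_length (n : nat) (x : bpath) : Prop :=
  match x with
  | FinPath _ l => (n <= size l)%N
  | InfPath _ => True
  end.

(* the vertex x(n), meaningful when n <= |x| *)
Definition nth_vertex (x : bpath) (n : nat) : vertex E :=
  match x with
  | FinPath v l => nth v (v :: map (@src E) l) n
  | InfPath y => if n is m.+1 then src (y m) else rng (y 0%N)
  end.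

Definition cofinal : Prop :=
  forall v (x : bpath), is_bpath x ->
    exists2 n, le_length n x & connects v (nth_vertex x n).

(* [cycle composable mu] also requires the source of the last edge to be the
   range of the first one. *)
Definition is_cycle mu : bool :=
  [&& mu != [::], cycle composable mu & uniq (map (@src E) mu)].

Definition no_entrance mu : Prop :=
  forall e f, f \in mu -> rng e = rng f -> e = f.

(* [mu], the set of cyclic permutations of mu *)
Definition cyclic_class mu : set (seq (edge E)) :=
  [set nu | exists k, nu = rot k mu].

(* C(E) *)
Definition entry_free_classes : set (set (seq (edge E))) :=
  [set C | exists mu, [/\ is_cycle mu, no_entrance mu & C = cyclic_class mu]].

(* C^1; all members of [mu] have the same edges, so [mu]^1 = {mu_i} *)
Definition class_edges (C : set (seq (edge E))) : set (edge E) :=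
  [set e | exists2 mu, C mu & e \in mu].

Definition cutting_set (X : set (edge E)) : Prop :=
  X `<=` \bigcup_(C in entry_free_classes) class_edges C /\
  forall C, entry_free_classes C -> exists e, X `&` class_edges C = [set e].

End Graph.

(* Complex C*-algebras, not assumed unital and possibly zero. The norm of a
   normed R[i]-module takes its values in the nonnegative reals of R[i]. *)
HB.mixin Record isCStarAlgebra (R : realType) A
    & CompleteNormedModule R[i] A := {
  amul : A -> A -> A;
  star : A -> A;
  amulA : associative amul;
  amulDl : left_distributive amul +%R;
  amulDr : right_distributive amul +%R;
  amulZl : forall (c : R[i]) (a b : A), amul (c *: a) b = c *: amul a b;
  amulZr : forall (c : R[i]) (a b : A), amul a (c *: b) = c *: amul a b;
  starK : involutive star;
  starD : {morph star : a b / a + b};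
  starZ : forall (c : R[i]) (a : A), star (c *: a) = conjc c *: star a;
  starM : forall a b : A, star (amul a b) = amul (star b) (star a);
  norm_amul_le : forall a b : A, `|amul a b| <= `|a| * `|b|;
  norm_star_amul : forall a : A, `|amul (star a) a| = `|a| ^+ 2 }.

#[short(type="cstarType")]
HB.structure Definition CStarAlgebra (R : realType) :=
  {A of CompleteNormedModule R[i] A & isCStarAlgebra R A}.

Declare Scope cstar_scope.
Notation "a ** b" := (amul a b)
  (at level 40, left associativity) : cstar_scope.
Local Open Scope cstar_scope.

Section CStar.
Variables (R : realType) (A : cstarType R).

Definition positive (a : A) : Prop := exists c, a = star c ** c.

Definition cstar_le (a b : A) : Prop := positive (b - a).

Definition projection (a : A) : Prop := a ** a = a /\ star a = a.

Definition cstar_subalgebra (S : set A) : Prop :=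
  [/\ closed S, S 0,
      forall (c : R[i]) a b, S a -> S b -> S (c *: a + b),
      forall a b, S a -> S b -> S (a ** b) &
      forall a, S a -> S (star a)].

(* C*(G) *)
Definition cstar_gen (G : set A) : set A := smallest cstar_subalgebra G.

Definition closed_ideal (I : set A) : Prop :=
  [/\ closed I, I 0,
      forall (c : R[i]) a b, I a -> I b -> I (c *: a + b) &
      forall a b, I a -> I (a ** b) /\ I (b ** a)].

Definition simple_cstar : Prop :=
  forall I, closed_ideal I -> I = [set 0] \/ I = setT.

End CStar.

(* psi restricts to a *-homomorphism on the subalgebra D; its values outside D
   are irrelevant. *)
Definition star_hom_on (R : realType) (B A : cstarType R) (D : set B)
    (psi : B -> A) : Prop :=
  [/\ forall (c : R[i]) a b, D a -> D b -> psi (c *: a + b) = c *: psi a + psi b,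
      forall a b, D a -> D b -> psi (a ** b) = psi a ** psi b &
      forall a, D a -> psi (star a) = star (psi a)].

Section Families.
Variables (R : realType) (E : digraph) (A : cstarType R).
Variables (p : vertex E -> A) (s : edge E -> A).

Definition TCK_family : Prop :=
  [/\ forall v, projection (p v),
      forall v w, v <> w -> p v ** p w = 0,
      forall e, star (s e) ** s e = p (src e) &
      forall v (F : set (edge E)), finite_set F -> F `<=` edges_to v ->
        cstar_le (\sum_(e \in F) (s e ** star (s e))) (p v)].

Definition CK_family : Prop :=
  TCK_family /\
  forall v, edges_to v !=set0 -> finite_set (edges_to v) ->
    p v = \sum_(e \in edges_to v) (s e ** star (s e)).

(* s_lambda for the path lambda of positive length with edges e :: l *)
Definition path_elt (e : edge E) (l : seq (edge E)) : A :=
  foldl (fun a f => a ** s f) (s e) l.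

Definition normalised_reduced_CK_family : Prop :=
  CK_family /\
  forall e l, is_cycle (e :: l) -> no_entrance (e :: l) ->
    path_elt e l = p (rng e).

Definition family_cstar : set A := cstar_gen (range p `|` range s).

End Families.

(* A, together with the family (p, s), is the co-universal algebra C*_min(E). *)
Definition is_cstar_min (R : realType) (E : digraph) (A : cstarType R)
    (p : vertex E -> A) (s : edge E -> A) : Prop :=
  [/\ normalised_reduced_CK_family p s,
      family_cstar p s = setT,
      forall v, p v <> 0 &
      forall (B : cstarType R) (q : vertex E -> B) (t : edge E -> B)
             (X : set (edge E)),
        TCK_family q t -> (forall v, q v <> 0) -> cutting_set X ->
        exists (kappa : edge E -> R[i]) (psi : B -> A),
          [/\ forall x, X x -> `|kappa x| = 1,
              star_hom_on (family_cstar q t) psi,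
              forall v, psi (q v) = p v,
              forall e, ~ X e -> psi (t e) = s e &
              forall x, X x -> psi (t x) = kappa x *: s x]].

(* Main.v *)
Require Import Defs.
From HB Require Import structures.
From mathcomp Require Import all_boot all_order all_algebra.
From mathcomp Require Import all_classical all_reals all_analysis.
From mathcomp Require Import finmap generic_quotient ring_quotient complex.
From mathcomp Require Import ring lra.

(** Let E be row-finite and let A be its co-universal algebra.

    If E is not cofinal, some vertex v reaches no vertex of some boundary path
    x.  The elements a such that a c s_{x_1...x_m} tends to 0 for every c in A
    form a closed ideal.  It is not A, since s_{x_1...x_m} has norm 1, and it
    contains p_v: the generators carry the sequences s_l s_{x_k...x_m} to
    sequences of the same kind or to 0, and p_v kills all of them because v
    does not reach x ([tail_ideal]).  As p_v is nonzero, A is not simple.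

    If E is cofinal, let I be a closed ideal.  The vertices v with p_v in I form
    a hereditary and saturated set.  If it is not empty, it is everything:
    otherwise a boundary path could be led through its complement, against
    cofinality ([vertex_ideal_full]); then I is A.  If it is empty, the images
    of the generators in A/I are a Toeplitz-Cuntz-Krieger family with nonzero
    vertex projections, so co-universality gives a homomorphism psi from A/I
    back to A.  The normalisation s_mu = p_{r(mu)} forces every scalar kappa(x)
    to be 1, hence psi splits the quotient map and I is 0
    ([ideal_trivial_of_no_vertex]).

    Three facts on C*-algebras enter, and they are obtained without spectral
    theory.  All rest on the remark that a^*b = b^*a implies
    |a + ib|^2 = |a^*a + b^*b| = |a - ib|^2 and hence |a| <= |a + ib|
    ([nr_le_addi]).
    - The quotient norm satisfies the C*-identity ([quotient_norm_sqr]), because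
      the resolvents of i times a self-adjoint element of I are contractions and
      provide an approximate unit.
    - Homomorphisms are contractive ([hom_contractive]): for self-adjoint h with
      |h| < 1, 1 - h^2 is a square (1 - k)^2, where k is the fixed point of a
      contraction, and the image of h then satisfies v^2 + (1 - l)^2 = 1.
    - If projections q_i sum to a projection p, then p q_i = q_i
      ([sum_projection_absorb]), which yields p_{r(e)} s_e = s_e and the
      orthogonality of distinct edges from the Cuntz-Krieger relation.  Being
      positive is replaced by being accretive, |y + tky| >= |y| for t >= 0,
      which is stable under sums; that a positive element with positive
      opposite vanishes follows from an explicit identity between polynomials
      ([butterworth]). *)
Set Implicit Arguments.
Unset Strict Implicit.
Unset Printing Implicit Defensive.

Import Order.TTheory GRing.Theory Num.Theory.
Import numFieldNormedType.Exports.

Local Open Scope classical_set_scope.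
Local Open Scope ring_scope.
Local Open Scope cstar_scope.
Local Open Scope complex_scope.

(** * The real-valued norm and completeness *)

Section Norm.
Variables (R : realType) (A : cstarType R).
Implicit Types (a b c x y : A).

Lemma amul0l a : 0 ** a = 0.
Proof. by have := amulZl 0 0 a; rewrite !scale0r. Qed.

Lemma amul0r a : a ** 0 = 0.
Proof. by have := amulZr 0 a 0; rewrite !scale0r. Qed.

Lemma amulNl a b : (- a) ** b = - (a ** b).
Proof. by rewrite -scaleN1r amulZl scaleN1r. Qed.

Lemma amulNr a b : a ** (- b) = - (a ** b).
Proof. by rewrite -scaleN1r amulZr scaleN1r. Qed.

Lemma amulBl a b c : (a - b) ** c = a ** c - b ** c.
Proof. by rewrite amulDl amulNl. Qed.

Lemma amulBr a b c : a ** (b - c) = a ** b - a ** c.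
Proof. by rewrite amulDr amulNr. Qed.

Lemma star0 : star 0 = 0 :> A.
Proof. by have := starZ 0 (0 : A); rewrite !scale0r => ->; rewrite rmorph0 scale0r. Qed.

Lemma starN a : star (- a) = - star a.
Proof. by rewrite -scaleN1r starZ rmorphN1 scaleN1r. Qed.

Lemma starB a b : star (a - b) = star a - star b.
Proof. by rewrite starD starN. Qed.

Lemma starZr (r : R) a : star (r%:C *: a) = r%:C *: star a.
Proof. by rewrite starZ /= oppr0. Qed.

(** The norm of a module over R[i] has values in R[i]; its real part is the same
    number in the ordered field R, where inequalities can be decided. *)
Definition nr a : R := complex.Re `|a|.

Lemma normE a : `|a| = (nr a)%:C.
Proof.
have : `|a| \is Num.real by apply: ger0_real.
by rewrite /nr => /complex_realP [k ->].
Qed.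

Lemma nr_ge0 a : 0 <= nr a.
Proof. by rewrite -ler0c -normE. Qed.

Lemma nr0 : nr 0 = 0. Proof. by rewrite /nr normr0. Qed.

Lemma nr0_eq0 a : nr a = 0 -> a = 0.
Proof. by move=> h; apply/normr0_eq0; rewrite normE h. Qed.

Lemma nrD a b : nr (a + b) <= nr a + nr b.
Proof. by rewrite -lecR rmorphD /= -!normE ler_normD. Qed.

Lemma nrN a : nr (- a) = nr a. Proof. by rewrite /nr normrN. Qed.

Lemma nrB a b : nr (a - b) = nr (b - a).
Proof. by rewrite -nrN opprB. Qed.

Lemma nr_subl a b : nr a <= nr (a - b) + nr b.
Proof. by rewrite -{1}(subrK b a) nrD. Qed.

Lemma nr_tri a b c : nr (a - c) <= nr (a - b) + nr (b - c).
Proof. by rewrite -{1}(subrK b a) -addrA nrD. Qed.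

Lemma nrZ (z : R[i]) a : nr (z *: a) = complex.Re `|z| * nr a.
Proof.
apply/complexI; rewrite rmorphM -normE normrZ normE; congr (_ * _).
Qed.

Lemma nrZr (r : R) a : nr (r%:C *: a) = `|r| * nr a.
Proof. by rewrite nrZ normc_def /= expr0n addr0 sqrtr_sqr. Qed.

Lemma nrZi a : nr ('i *: a) = nr a.
Proof. by rewrite nrZ normc_def /= expr0n add0r expr1n sqrtr1 mul1r. Qed.

Lemma nrM a b : nr (a ** b) <= nr a * nr b.
Proof. by rewrite -lecR rmorphM /= -!normE norm_amul_le. Qed.

Lemma nr_sqr a : nr (star a ** a) = nr a ^+ 2.
Proof. by apply/complexI; rewrite rmorphXn /= -!normE norm_star_amul. Qed.

Lemma nr_star a : nr (star a) = nr a.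
Proof.
have h b : nr b <= nr (star b).
  have [->|b0] := eqVneq (nr b) 0; first exact: nr_ge0.
  have b1 : 0 < nr b by rewrite lt_def b0 nr_ge0.
  by have := nrM (star b) b; rewrite nr_sqr expr2 ler_pM2r.
by apply/eqP; rewrite eq_le h -{2}(starK a) h.
Qed.

Lemma nr_sqr_self a : star a = a -> nr (a ** a) = nr a ^+ 2.
Proof. by move=> h; rewrite -nr_sqr h. Qed.

Lemma conjc_i : conjc 'i = - 'i :> R[i].
Proof. by apply/eqP; rewrite eq_complex /= oppr0 !eqxx. Qed.

Lemma star_addi a b : star (a + 'i *: b) = star a - 'i *: star b.
Proof. by rewrite starD starZ conjc_i scaleNr. Qed.

(** Under this condition the cross terms of (a + ib)^*(a + ib) cancel.  It holds
    when a and b are the images of one vector under commuting self-adjoint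
    operators, and it replaces the Pythagorean theorem of the functional
    calculus. *)
Lemma nr_addi_sqr a b : star a ** b = star b ** a ->
  nr (a + 'i *: b) ^+ 2 = nr (star a ** a + star b ** b).
Proof.
move=> h; rewrite -nr_sqr star_addi amulBl !amulDr !amulZr !amulZl h scalerA.
rewrite -expr2 sqr_i scaleN1r opprD opprK addrA; congr (nr (_ + _)).
by rewrite addrK.
Qed.

(** a + ib and a - ib have the same norm, and a and ib are half their sum and
    half their difference. *)
Lemma nr_le_addi a b : star a ** b = star b ** a ->
  nr a <= nr (a + 'i *: b) /\ nr b <= nr (a + 'i *: b).
Proof.
move=> h.
have e : nr (a - 'i *: b) = nr (a + 'i *: b).
  have h' : star a ** (- b) = star (- b) ** a by rewrite amulNr starN amulNl h.
  apply/(@pexpIrn _ 2) => //; rewrite ?nnegrE ?nr_ge0//.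
  by rewrite (nr_addi_sqr h) -scalerN (nr_addi_sqr h') amulNr starN amulNl opprK.
have e1 := nrD (a + 'i *: b) (a - 'i *: b).
have e2 := nrD (a + 'i *: b) (- (a - 'i *: b)).
rewrite nrN e in e1 e2; split.
- move: e1; rewrite addrACA subrr addr0 -mulr2n -scaler_nat.
  rewrite -[2%:R](rmorph_nat (@real_complex R)) nrZr ger0_norm//; lra.
- move: e2; rewrite opprD opprK addrACA subrr add0r -mulr2n -scaler_nat.
  rewrite -[2%:R](rmorph_nat (@real_complex R)) nrZr nrZi ger0_norm//; lra.
Qed.

Lemma nr_le_sum_sqr a b : star a ** b = star b ** a ->
  nr a ^+ 2 <= nr (star a ** a + star b ** b) /\
  nr b ^+ 2 <= nr (star a ** a + star b ** b).
Proof.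
move=> h; have [h1 h2] := nr_le_addi h; rewrite -(nr_addi_sqr h).
by split; rewrite lerXn2r// ?nnegrE nr_ge0.
Qed.

Lemma closed_limP (S : set A) : closed S <->
  forall l, (forall e : R, 0 < e -> exists2 a, S a & nr (l - a) < e) -> S l.
Proof.
split=> [cS l hl|h l cl].
- apply: cS => B /nbhs_ballP[e e0 Be].
  have er : e = (complex.Re e)%:C by rewrite RRe_real// gtr0_real.
  have e0' : 0 < complex.Re e by rewrite -ltcR -er.
  have [a Sa la] := hl _ e0'.
  exists a; split => //; apply: Be.
  by rewrite -ball_normE /ball_/= normE er ltcR.
- apply: h => e e0.
  have [|a [Sa Ba]] := cl (ball l e%:C).
    by apply: nbhsx_ballx; rewrite ltcR.
  by exists a => //; move: Ba; rewrite -ball_normE /ball_/= normE ltcR.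
Qed.

Lemma geometric_small (C q e : R) : 0 <= q < 1 -> 0 < e ->
  exists N, forall n, (N <= n)%N -> C * q ^+ n < e.
Proof.
move=> /andP[q0 q1] e0.
have : geometric C q @ \oo --> 0 by apply: cvg_geometric; rewrite ger0_norm.
move=> /cvgrPdist_lt /(_ _ e0)[N _ hN]; exists N => n Nn.
by have := hN n Nn; rewrite /= sub0r normrN; apply: le_lt_trans; exact: ler_norm.
Qed.

Lemma geometric_dist (x : nat -> A) (C q : R) : 0 <= q < 1 ->
  (forall n, nr (x n.+1 - x n) <= C * q ^+ n) ->
  forall n m, nr (x (n + m)%N - x n) <= C / (1 - q) * q ^+ n.
Proof.
move=> /andP[q0 q1] hx n m.
have C0 : 0 <= C by have := le_trans (nr_ge0 _) (hx 0%N); rewrite mulr1.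
have q1' : 0 < 1 - q by lra.
suff h : nr (x (n + m)%N - x n) <= C / (1 - q) * (q ^+ n - q ^+ (n + m)).
  apply: le_trans h _; apply: ler_wpM2l; first by rewrite divr_ge0// ltW.
  by rewrite lerBlDr lerDl exprn_ge0.
elim: m => [|m IH]; first by rewrite addn0 !subrr nr0 mulr0.
rewrite addnS; apply: le_trans (nr_tri _ (x (n + m)%N) _) _.
apply: le_trans (lerD (hx _) IH) _.
have -> : C * q ^+ (n + m) = C / (1 - q) * (q ^+ (n + m) - q ^+ (n + m).+1).
  by rewrite exprS; field; lra.
by rewrite -mulrDr [leLHS]mulrC [leRHS]mulrC addrC subrKA.
Qed.

Lemma geometric_cvg (x : nat -> A) (C q : R) : 0 <= q < 1 ->
  (forall n, nr (x n.+1 - x n) <= C * q ^+ n) ->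
  exists l, forall n, nr (l - x n) <= C / (1 - q) * q ^+ n.
Proof.
move=> q01 hx; have hd := geometric_dist q01 hx.
have : cvg (x @ \oo).
  apply/cauchy_cvgP/cauchy_exP => e e0.
  have er : e = (complex.Re e)%:C by rewrite RRe_real// gtr0_real.
  have e0' : 0 < complex.Re e by rewrite -ltcR -er.
  have [N hN] := geometric_small (C / (1 - q)) q01 e0'.
  exists (x N); exists N => // n /= Nn.
  rewrite -ball_normE /ball_/= normE er ltcR.
  by rewrite nrB -(subnKC Nn); apply: le_lt_trans (hd _ _) (hN _ (leqnn _)).
move=> /cvg_ex[l xl]; exists l => n; apply/ler_addgt0Pr => e e0.
move/cvgrPdist_lt : xl => /(_ e%:C); rewrite ltcR => /(_ e0)[N _ hN].
have := hN (n + N)%N (leq_addl _ _); rewrite /= normE ltcR => h.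
by apply: le_trans (nr_tri _ (x (n + N)%N) _) _; rewrite addrC lerD// ltW.
Qed.

(** Banach's theorem for modules over the complex numbers: elements of A defined by
    a quadratic or linear equation are found in this way inside any closed set
    that the iteration preserves. *)
Lemma fixed_point (U : set A) (f : A -> A) (q : R) (x0 : A) :
  closed U -> 0 <= q < 1 -> U x0 -> (forall x, U x -> U (f x)) ->
  (forall x y, U x -> U y -> nr (f x - f y) <= q * nr (x - y)) ->
  exists2 x, U x & f x = x.
Proof.
move=> /closed_limP cU q01 Ux0 Uf fq; have /andP[q0 q1] := q01.
pose x n := iter n f x0.
have Ux n : U (x n) by elim: n => //= n; exact: Uf.
have hx n : nr (x n.+1 - x n) <= nr (x 1%N - x 0%N) * q ^+ n.
  elim: n => [|n IH]; first by rewrite mulr1.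
  apply: le_trans (fq (x n.+1) (x n) (Ux _) (Ux _)) _.
  by rewrite exprS mulrCA ler_wpM2l.
have [l xl] := geometric_cvg q01 hx.
set C := _ / _ in xl.
have Ul : U l.
  apply: cU => e e0; have [N /(_ N (leqnn _)) hN] := geometric_small C q01 e0.
  by exists (x N) => //; exact: le_lt_trans (xl N) hN.
exists l => //; apply/eqP; rewrite -subr_eq0; apply/eqP/nr0_eq0.
apply/eqP; rewrite eq_le nr_ge0 andbT; apply/ler_addgt0Pr => e e0.
have [|N hN] := @geometric_small C q (e / 2) q01; first by lra.
rewrite add0r; apply: le_trans (nr_tri _ (x N.+1) _) _.
have h1 : nr (f l - x N.+1) <= e / 2.
  apply: le_trans (fq _ _ Ul (Ux N)) _.
  have := hN N (leqnn _); have := xl N; have := nr_ge0 (l - x N); nra.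
have := hN N.+1 (leqnSn _); have := xl N.+1; rewrite (nrB (x _)) => h2 h3; lra.
Qed.

End Norm.

(** * Approximate units of closed ideals *)

Lemma le_of_sqr (R : realType) (u v : R) : 0 <= v -> u ^+ 2 <= v ^+ 2 -> u <= v.
Proof. by move=> v0 h; rewrite leNgt; apply/negP => ?; nra. Qed.

Section ClosedSets.
Variables (R : realType) (A B : cstarType R).

Lemma closed_lipschitz (F : A -> B) (C : R) (S : set B) : closed S ->
  (forall x y, nr (F x - F y) <= C * nr (x - y)) -> closed (F @^-1` S).
Proof.
move=> /closed_limP cS FC; apply/closed_limP => l hl; apply: cS => e e0.
have C1 : 0 < `|C| + 1 by rewrite ltr_wpDl.
have [a Sa la] := hl (e / (`|C| + 1)) (divr_gt0 e0 C1).
exists (F a) => //; apply: le_lt_trans (FC _ _) _.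
rewrite ltr_pdivlMr// mulrC in la; apply: le_lt_trans la.
by rewrite ler_wpM2r ?nr_ge0//; have := ler_norm C; lra.
Qed.

Lemma closed_zero : closed [set (0 : A)].
Proof.
apply/closed_limP => l hl; apply/nr0_eq0/eqP; rewrite eq_le nr_ge0 andbT.
by apply/ler_addgt0Pr => e /hl[a ->]; rewrite subr0 add0r => /ltW.
Qed.

Lemma closed_nr_ball (r : R) : closed [set a : A | nr a <= r].
Proof.
apply/closed_limP => l hl; apply/ler_addgt0Pr => e /hl[a /= ar la].
have := nr_subl l a; lra.
Qed.

End ClosedSets.

Section Lipschitz.
Variables (R : realType) (A : cstarType R).
Implicit Types (a b x y : A).

Lemma amull_lip a x y : nr (a ** x - a ** y) <= nr a * nr (x - y).
Proof. by rewrite -amulBr nrM. Qed.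

Lemma star_lip x y : nr (star x - star y) <= 1 * nr (x - y).
Proof. by rewrite -starB nr_star mul1r. Qed.

Lemma closed_star_self : closed [set a : A | star a = a].
Proof.
rewrite (_ : mkset _ = (fun a => star a - a) @^-1` [set 0]).
  apply: (@closed_lipschitz _ _ _ _ 2) => [|x y]; first exact: closed_zero.
  rewrite opprD opprK addrACA [- x + y]addrC -starB.
  apply: le_trans (nrD _ _) _; rewrite nr_star (nrB y x); lra.
apply/seteqP; split=> a /=; first by move=> ->; rewrite subrr.
by move/eqP; rewrite subr_eq0 => /eqP.
Qed.

Lemma closed_commute b : closed [set a : A | b ** a = a ** b].
Proof.
rewrite (_ : mkset _ = (fun a => b ** a - a ** b) @^-1` [set 0]).
  apply: (@closed_lipschitz _ _ _ _ (2 * nr b)) => [|x y].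
    exact: closed_zero.
  rewrite opprD opprK addrACA [- (x ** b) + _]addrC -amulBr -amulBl.
  apply: le_trans (nrD _ _) _.
  have := nrM b (x - y); have := nrM (y - x) b; rewrite (nrB y x); lra.
apply/seteqP; split=> a /=; first by move=> ->; rewrite subrr.
by move/eqP; rewrite subr_eq0 => /eqP.
Qed.

End Lipschitz.

Section Ideals.
Variables (R : realType) (A : cstarType R) (I : set A) (hI : closed_ideal I).
Implicit Types (a b c j r x y : A).

Lemma ideal0 : I 0. Proof. by case: hI. Qed.

Lemma idealD a b : I a -> I b -> I (a + b).
Proof. by case: hI => _ _ h _ Ia Ib; rewrite -(scale1r a); exact: h. Qed.

Lemma idealZ (c : R[i]) a : I a -> I (c *: a).
Proof. by case: hI => _ I0 h _ Ia; rewrite -(addr0 (c *: a)); exact: h. Qed.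

Lemma idealN a : I a -> I (- a).
Proof. by move=> Ia; rewrite -scaleN1r; exact: idealZ. Qed.

Lemma idealB a b : I a -> I b -> I (a - b).
Proof. by move=> Ia Ib; apply: idealD => //; exact: idealN. Qed.

Lemma ideal_mulr a b : I a -> I (a ** b).
Proof. by case: hI => _ _ _ h /(h a b)[]. Qed.

Lemma ideal_mull a b : I a -> I (b ** a).
Proof. by case: hI => _ _ _ h /(h a b)[]. Qed.

Lemma ideal_closed : closed I. Proof. by case: hI. Qed.

(** The equation says (1 + i beta)(1 - r) = 1.  Since beta is self-adjoint,
    |c - i beta|^2 <= c^2 + |beta|^2, so that the equivalent equation
    (1 + c) r = i beta + (c - i beta) r has a contracting right-hand side for
    c = |beta|^2; its iterates stay in the ideal. *)
Lemma cayley_solution beta : I beta -> star beta = beta ->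
  exists2 r, I r & r = 'i *: beta - 'i *: (beta ** r).
Proof.
move=> Ib sb; pose c := nr beta ^+ 2.
have c0 : 0 <= c by rewrite exprn_ge0// nr_ge0.
have c1 : 0 < 1 + c by lra.
pose f r := ((1 + c)^-1)%:C *: ('i *: beta + (c%:C *: r - 'i *: (beta ** r))).
pose q := Num.sqrt (c / (1 + c)).
have [|||x Ix|x y _ _|r Ir fr] := @fixed_point _ _ I f q 0.
- exact: ideal_closed.
- rewrite sqrtr_ge0 /= -[ltRHS]sqrtr1 ltr_sqrt// ltr_pdivrMr//; lra.
- exact: ideal0.
- do ![apply: idealZ|apply: idealD|apply: idealN] => //; exact: ideal_mulr.
- have -> : f x - f y = ((1 + c)^-1)%:C *:
      (c%:C *: (x - y) + 'i *: - (beta ** (x - y))).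
    rewrite /f -scalerBr; congr (_ *: _).
    rewrite opprD addrACA subrr add0r opprD opprK addrACA [X in _ + X]addrC.
    by rewrite -!scalerBr -amulBr -(opprB x) amulNr.
  rewrite nrZr ger0_norm ?invr_ge0 ?(ltW c1)//.
  set z := x - y; set N := nr (_ + _).
  have hN : N ^+ 2 <= (c ^+ 2 + c) * nr z ^+ 2.
    rewrite /N nr_addi_sqr; last first.
      by rewrite starZr starN starM sb amulZl amulZr amulNl amulNr amulA.
    apply: le_trans (nrD _ _) _; rewrite !nr_sqr nrZr nrN ger0_norm//.
    have := nrM beta z; have := nr_ge0 (beta ** z).
    have := nr_ge0 z; have := nr_ge0 beta; rewrite /c.
    move: (nr z) (nr beta) (nr (beta ** z)) => u v w u0 v0 w0 wuv.
    have : w ^+ 2 <= (v * u) ^+ 2 by rewrite lerXn2r ?nnegrE ?mulr_ge0.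
    rewrite !exprMn; lra.
  apply: le_of_sqr; first by rewrite mulr_ge0 ?sqrtr_ge0 ?nr_ge0.
  rewrite [leRHS]exprMn sqr_sqrtr ?divr_ge0 ?(ltW c1)// exprMn.
  have h0 : 0 <= (1 + c)^-1 ^+ 2 by rewrite exprn_ge0 ?invr_ge0 ?(ltW c1).
  apply: (le_trans (ler_wpM2l h0 hN)).
  by rewrite le_eqVlt; apply/orP; left; apply/eqP; field; exact: lt0r_neq0.
exists r => //; move: fr => /(congr1 (fun a => (1 + c)%:C *: a)).
rewrite /f scalerA -rmorphM /= mulfV ?lt0r_neq0// scale1r rmorphD scalerDl scale1r.
by move=> e; apply: (@addIr _ (c%:C *: r)); rewrite -e addrA addrAC.
Qed.

(** With (1 + i t b)(1 - r) = 1, the operator 1 - r is a contraction, because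
    1 + i t b does not decrease norms.  Moreover t (b - b r) = - i r has norm at
    most 2, so that b - b r is small for large t. *)
Lemma approximate_unit b (d : R) : I b -> star b = b -> 0 < d ->
  exists r, [/\ I r, I (star r), forall x, nr (x - r ** x) <= nr x,
    forall x, nr (x - star r ** x) <= nr x & nr (b - b ** r) <= d].
Proof.
move=> Ib sb d0; pose t := 2 / d.
have t0 : 0 < t by rewrite divr_gt0.
pose beta := t%:C *: b.
have sbeta : star beta = beta by rewrite starZr sb.
have Ibeta : I beta by exact: idealZ.
have [r Ir hr] := cayley_solution Ibeta sbeta.
have contr x : nr (x - r ** x) <= nr x.
  set y := x - r ** x.
  have hy : y + 'i *: (beta ** y) = x.
    have -> : 'i *: (beta ** y) = r ** x.
      by rewrite /y amulBr scalerBr [in RHS]hr amulBl !amulZl amulA.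
    by rewrite subrK.
  rewrite -[X in _ <= nr X]hy; apply: (nr_le_addi _).1.
  by rewrite starM sbeta amulA.
have contr' x : nr (x - star r ** x) <= nr x.
  set z := x - star r ** x.
  have [->|z0] := eqVneq (nr z) 0; first exact: nr_ge0.
  have z1 : 0 < nr z by rewrite lt_def z0 nr_ge0.
  rewrite -(ler_pM2r z1) -expr2 -nr_sqr.
  have -> : star z ** z = star x ** (z - r ** z).
    by rewrite {1}/z starB starM starK amulBl amulBr amulA.
  apply: le_trans (nrM _ _) _; rewrite nr_star.
  by rewrite ler_wpM2l ?nr_ge0.
have r2 : nr r <= 2.
  have [->|r0] := eqVneq (nr r) 0; first by [].
  have r1 : 0 < nr r by rewrite lt_def r0 nr_ge0.
  rewrite -(ler_pM2r r1) -expr2 -(nr_star r) -nr_sqr starK.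
  rewrite -(subKr (star r) (r ** star r)); apply: le_trans (nrD _ _) _.
  by rewrite nrN; have := contr (star r); rewrite !nr_star; lra.
exists r; split => //.
  rewrite hr starB (starZ _ beta) (starZ _ (beta ** r)) starM sbeta.
  by apply: idealB; apply: idealZ => //; exact: ideal_mull.
have h : nr r = t * nr (b - b ** r).
  by rewrite {1}hr -scalerBr nrZi /beta amulZl -scalerBr nrZr gtr0_norm.
by rewrite h /t mulrAC ler_pdivrMr// in r2; lra.
Qed.

(** The self-adjoint case applies to j^*j, since |j - j r|^2 is the norm of
    (1 - r)^* (j^*j - j^*j r). *)
Lemma approximate_right_unit j (d : R) : I j -> 0 < d ->
  exists r, [/\ I r, I (star r), forall x, nr (x - r ** x) <= nr x,
    forall x, nr (x - star r ** x) <= nr x & nr (j - j ** r) <= d].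
Proof.
move=> Ij d0; have d20 : 0 < d ^+ 2 by rewrite exprn_gt0.
have [||r [Ir Isr h1 h2 h3]] := @approximate_unit (star j ** j) (d ^+ 2) _ _ d20.
- exact: ideal_mull.
- by rewrite starM starK.
exists r; split => //.
apply: le_of_sqr; first exact: ltW.
apply: le_trans h3.
rewrite -nr_sqr starB starM amulBl -(amulA (star r)).
by rewrite (amulBr (star j)) amulA; exact: h2.
Qed.

(** j^* is the limit of the elements r^*j^*, which lie in I. *)
Lemma ideal_star j : I j -> I (star j).
Proof.
move=> Ij; move/closed_limP : ideal_closed; apply => e e0.
have [|r [_ Isr _ _ h]] := @approximate_right_unit j (e / 2) Ij; first by lra.
exists (star (j ** r)); first by rewrite starM; exact: ideal_mulr.
by rewrite -starB nr_star; lra.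
Qed.

(** The C*-identity of the quotient norm: k = - a r, for an approximate unit r
    that almost absorbs j, satisfies
    |a + k|^2 = |(1 - r)^* a^*a (1 - r)| <= |a^*a + j| + |j - j r|. *)
Lemma quotient_norm_sqr a j (e : R) : I j -> 0 < e ->
  exists2 k, I k & nr (a + k) ^+ 2 <= nr (star a ** a + j) + e.
Proof.
move=> Ij e0; have [r [Ir Isr h1 h2 h3]] := approximate_right_unit Ij e0.
exists (- (a ** r)); first by apply/idealN/ideal_mull.
pose g x := x - star r ** x.
have hr x : nr (x - x ** r) <= nr x.
  by rewrite -nr_star starB starM -(nr_star x).
have -> : nr (a - a ** r) ^+ 2 = nr (g (star a ** a - star a ** a ** r)).
  by rewrite -nr_sqr starB starM amulBl -(amulA (star r)) (amulBr (star a)) amulA.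
set c := star a ** a.
have -> : c - c ** r = ((c + j) - (c + j) ** r) - (j - j ** r).
  by rewrite amulDl opprD addrACA addrK.
have gB u v : g (u - v) = g u - g v.
  by rewrite /g amulBr !opprD !opprK addrACA.
rewrite gB.
apply: le_trans (nrD _ _) _; rewrite nrN lerD//.
  by apply: le_trans (h2 _) _.
by apply: le_trans (h2 _) _.
Qed.

End Ideals.

(** * Star-homomorphisms are contractive *)

Lemma le1_of_sqr_sqr (R : realType) (u : R) :
  0 <= u -> u ^+ 2 ^+ 2 <= u ^+ 2 -> u <= 1.
Proof.
move=> u0 h; rewrite leNgt; apply/negP => u1.
have h4 : 1 < u ^+ 2 by nra.
by move: (u ^+ 2) h4 h => w; nra.
Qed.

Section Subalgebra.
Variables (R : realType) (A : cstarType R) (D : set A).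
Hypothesis hD : cstar_subalgebra D.
Implicit Types (a b h k x y : A).

Lemma star_subalg_closed : closed D. Proof. by case: hD. Qed.

Lemma subalg0 : D 0. Proof. by case: hD. Qed.

Lemma subalgD a b : D a -> D b -> D (a + b).
Proof. by case: hD => _ _ h _ _ Da Db; rewrite -(scale1r a); exact: h. Qed.

Lemma subalgZ (c : R[i]) a : D a -> D (c *: a).
Proof. by case: hD => _ D0 h _ _ Da; rewrite -(addr0 (c *: a)); exact: h. Qed.

Lemma subalgN a : D a -> D (- a).
Proof. by move=> Da; rewrite -scaleN1r; exact: subalgZ. Qed.

Lemma subalgB a b : D a -> D b -> D (a - b).
Proof. by move=> Da Db; apply: subalgD => //; exact: subalgN. Qed.

Lemma subalgM a b : D a -> D b -> D (a ** b).
Proof. by case: hD => _ _ _ h _; exact: h. Qed.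

Lemma subalg_star a : D a -> D (star a).
Proof. by case: hD => _ _ _ _ h; exact: h. Qed.

(** The last equation reads (1 - k)^2 = 1 - h^2.  The map sending k to
    (h^2 + k^2)/2 contracts the ball of radius |h| by the factor |h|, and
    preserves self-adjointness and commutation with h. *)
Lemma square_root_of_one_sub_sqr h : D h -> star h = h -> nr h < 1 ->
  exists k, [/\ D k, star k = k, h ** k = k ** h & k + k = h ** h + k ** k].
Proof.
move=> Dh sh h1; have h0 := nr_ge0 h.
pose U := [set k | [/\ D k, star k = k, h ** k = k ** h & nr k <= nr h]].
pose f k := (2^-1 : R)%:C *: (h ** h + k ** k).
have cU : closed U.
  rewrite (_ : U = D `&` [set k | star k = k] `&` [set k | h ** k = k ** h]
                    `&` [set k | nr k <= nr h]); last first.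
    by apply/seteqP; split=> k /=; [case|case=> -[[]]].
  apply: closedI; last exact: closed_nr_ball.
  apply: closedI; last exact: closed_commute.
  by apply: closedI; [exact: star_subalg_closed|exact: closed_star_self].
have h01 : 0 <= nr h < 1 by rewrite h0.
have [|||k [Dk sk hk _] fk] := @fixed_point _ _ U f (nr h) 0 cU h01.
- by split; rewrite ?star0 ?amul0l ?amul0r ?nr0//; exact: subalg0.
- move=> k [Dk sk hk nk]; split.
  + by apply: subalgZ; apply: subalgD; exact: subalgM.
  + by rewrite starZr starD !starM sh sk.
  + rewrite /f amulZl amulZr amulDl amulDr amulA; congr (_ *: (_ + _)).
    by rewrite amulA hk -amulA hk amulA.
  + rewrite /f nrZr gtr0_norm ?invr_gt0//.
    have := nrD (h ** h) (k ** k); have := nrM h h; have := nrM k k.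
    have := nr_ge0 k; nra.
- move=> x y [_ _ _ nx] [_ _ _ ny].
  have -> : f x - f y = (2^-1 : R)%:C *: (x ** (x - y) + (x - y) ** y).
    rewrite /f -scalerBr; congr (_ *: _).
    by rewrite amulBr amulBl addrA subrK opprD addrACA subrr add0r.
  rewrite nrZr gtr0_norm ?invr_gt0//.
  have := nrD (x ** (x - y)) ((x - y) ** y).
  have := nrM x (x - y); have := nrM (x - y) y; have := nr_ge0 (x - y).
  move: (nr (x - y)) (nr (_ ** _)) (nr (_ ** _)) (nr (_ + _)) => u v w z.
  nra.
exists k; split => //.
have := congr1 (fun a => (2 : R)%:C *: a) fk.
rewrite /f scalerA -rmorphM /= mulfV// scale1r => ->.
by rewrite rmorph_nat scaler_nat mulr2n.
Qed.

End Subalgebra.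

Section Homomorphism.
Variables (R : realType) (A B : cstarType R) (D : set B) (psi : B -> A).
Hypotheses (hD : cstar_subalgebra D) (hpsi : star_hom_on D psi).

Lemma homD a b : D a -> D b -> psi (a + b) = psi a + psi b.
Proof.
by case: hpsi => h _ _ Da Db; rewrite -{1}(scale1r a) h// scale1r.
Qed.

Lemma hom0 : psi 0 = 0.
Proof.
apply: (@addIr _ (psi 0)); rewrite add0r -homD ?addr0//; exact: subalg0.
Qed.

Lemma homZ c a : D a -> psi (c *: a) = c *: psi a.
Proof.
case: hpsi => h _ _ Da; rewrite -(addr0 (c *: a)) h ?hom0 ?addr0//.
exact: subalg0.
Qed.

Lemma homB a b : D a -> D b -> psi (a - b) = psi a - psi b.
Proof.
move=> Da Db; rewrite -scaleN1r homD ?homZ ?scaleN1r//.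
by apply: subalgN.
Qed.

Lemma homM a b : D a -> D b -> psi (a ** b) = psi a ** psi b.
Proof. by case: hpsi => _ h _; exact: h. Qed.

Lemma hom_star a : D a -> psi (star a) = star (psi a).
Proof. by case: hpsi => _ _ h; exact: h. Qed.

(** Let v and l be the images of h and of the k with (1 - k)^2 = 1 - h^2.  Then
    v^2 + (1 - l)^2 = 1, so that v^2 is a summand in a sum of two commuting
    squares; evaluated on the vector v this gives |v^2| <= |v|. *)
Lemma hom_unit_ball h : D h -> star h = h -> nr h < 1 -> nr (psi h) <= 1.
Proof.
move=> Dh sh h1.
have [k [Dk sk hk ek]] := square_root_of_one_sub_sqr hD Dh sh h1.
set v := psi h; set l := psi k.
have sv : star v = v by rewrite -hom_star ?sh.
have sl : star l = l by rewrite -hom_star ?sk.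
have vl : v ** l = l ** v by rewrite -!homM ?hk.
have el : l + l = v ** v + l ** l.
  by rewrite -!homM// -!homD ?ek//; exact: subalgM.
pose a := v - l ** v.
have sa : star a ** a = v ** v - v ** v ** (v ** v).
  have sa : star a = a by rewrite starB starM sl sv vl.
  have av : a = v - v ** l by rewrite /a vl.
  have e : v ** v ** l + v ** v ** l = v ** v ** (v ** v) + v ** v ** (l ** l).
    by rewrite -!amulDr el.
  have -> : star a ** a = (v - v ** l) ** (v - l ** v) by rewrite sa -av.
  rewrite amulBl (amulBr v) (amulBr (v ** l)).
  have -> : v ** l ** v = v ** v ** l by rewrite -amulA -vl amulA.
  have -> : v ** (l ** v) = v ** v ** l by rewrite -vl amulA.
  have -> : v ** l ** (l ** v) = v ** v ** (l ** l).
    by rewrite -vl amulA -[v ** l ** v]amulA -vl !amulA.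
  by rewrite opprB addrACA -opprD e opprD addrACA subrr addr0.
have e1 : star a ** (v ** v) = star (v ** v) ** a.
  have -> : star a = a by rewrite starB starM sl sv vl.
  have lvv : l ** v ** (v ** v) = v ** v ** (l ** v).
    by rewrite !amulA -vl -(amulA v l v) -vl !amulA.
  by rewrite starM sv /a (amulBl v) (amulBr (v ** v)) lvv amulA.
have := (nr_le_sum_sqr e1).2.
have -> : star a ** a + star (v ** v) ** (v ** v) = v ** v.
  by rewrite sa starM sv subrK.
rewrite (nr_sqr_self sv) => h2.
exact: le1_of_sqr_sqr (nr_ge0 v) h2.
Qed.

Lemma hom_contractive b : D b -> nr (psi b) <= nr b.
Proof.
move=> Db; apply: le_of_sqr; first exact: nr_ge0.
rewrite -!nr_sqr -hom_star// -homM ?subalg_star//; last exact: subalg_star.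
set h := star b ** b.
have Dh : D h by apply: subalgM => //; exact: subalg_star.
have sh : star h = h by rewrite starM starK.
apply/ler_addgt0Pr => e e0.
have r0 : 0 < nr h + e by rewrite ltr_wpDl ?nr_ge0.
have := @hom_unit_ball ((nr h + e)^-1%:C *: h) _ _ _.
rewrite homZ// !nrZr gtr0_norm ?invr_gt0// => H.
have : (nr h + e)^-1 * nr (psi h) <= 1.
  apply: H.
  - exact: subalgZ.
  - by rewrite starZr sh.
  - by rewrite mulrC ltr_pdivrMr// mul1r ltrDl.
by rewrite mulrC ler_pdivrMr// mul1r.
Qed.

End Homomorphism.

(** * Projections whose sum is a projection *)

(** A convex function of t >= 0 that is bounded below by its value at 0 up to a
    quadratic error has its minimum at 0. *)
Lemma convex_slope (R : realType) (A : cstarType R) (a b : A) (C : R) :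
  0 <= C -> (forall s : R, 0 <= s -> nr a - C * s ^+ 2 <= nr (a + s%:C *: b)) ->
  forall t : R, 0 <= t -> nr a <= nr (a + t%:C *: b).
Proof.
move=> C0 h t t0.
have [->|tn0] := eqVneq t 0; first by rewrite scale0r addr0.
have tp : 0 < t by rewrite lt_def tn0.
apply/ler_addgt0Pr => e e0.
pose d := Num.min 1 (e / (C * t ^+ 2 + 1)).
have Ct : 0 <= C * t ^+ 2 by rewrite mulr_ge0// exprn_ge0.
have d0 : 0 < d by rewrite lt_min ltr01 divr_gt0// ltr_wpDl.
have d1 : d <= 1 by rewrite ge_min lexx.
have de : d * (C * t ^+ 2 + 1) <= e.
  by rewrite -ler_pdivlMr ?ltr_wpDl// ge_min lexx orbT.
have := h (d * t) (mulr_ge0 (ltW d0) t0).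
have -> : a + (d * t)%:C *: b = (1 - d)%:C *: a + d%:C *: (a + t%:C *: b).
  rewrite scalerDr scalerA -rmorphM addrA -scalerDl -rmorphD subrK.
  by rewrite scale1r.
have := nrD ((1 - d)%:C *: a) (d%:C *: (a + t%:C *: b)).
rewrite !nrZr !ger0_norm ?(ltW d0) ?subr_ge0//.
move: (nr a) (nr (_ + _)) (nr (_ + _)) => u v w h1 h2.
have hd : d * (d * (C * t ^+ 2)) <= d * e by rewrite ler_pM2l//; lra.
have : d * u <= d * (v + e) by rewrite exprMn in h2; lra.
by rewrite ler_pM2l.
Qed.

Section Accretive.
Variables (R : realType) (A : cstarType R).
Implicit Types (a b h k x y z p q r v : A).

(** For self-adjoint k this is positivity, in the form of a norm inequality that
    passes to sums without any functional calculus. *)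
Definition accretive k : Prop :=
  forall y (t : R), 0 <= t -> nr y <= nr (y + t%:C *: (k ** y)).

Lemma accretive0 : accretive 0.
Proof. by move=> y t _; rewrite amul0l scaler0 addr0. Qed.

(** (1 + s k1)(1 + s k2) does not decrease norms and differs from 1 + s (k1 + k2)
    by a term of order s^2. *)
Lemma accretiveD k1 k2 : accretive k1 -> accretive k2 -> accretive (k1 + k2).
Proof.
move=> h1 h2 y; apply: (@convex_slope _ _ _ _ (nr (k1 ** (k2 ** y)))).
  exact: nr_ge0.
move=> s s0; have := h1 (y + s%:C *: (k2 ** y)) s s0.
rewrite amulDr amulZr scalerDr scalerA -rmorphM -expr2.
have -> : y + s%:C *: (k2 ** y) + (s%:C *: (k1 ** y) +
    (s ^+ 2)%:C *: (k1 ** (k2 ** y))) =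
  y + s%:C *: ((k1 + k2) ** y) + (s ^+ 2)%:C *: (k1 ** (k2 ** y)).
  by rewrite amulDl scalerDr (addrC (s%:C *: (k1 ** y)) (s%:C *: _)) !addrA.
move=> h; have := nrD (y + s%:C *: ((k1 + k2) ** y))
                      ((s ^+ 2)%:C *: (k1 ** (k2 ** y))).
rewrite nrZr ger0_norm ?exprn_ge0// => h'.
have := h2 y s s0; lra.
Qed.

Lemma projection_contr q x : projection q -> nr (x - q ** x) <= nr x.
Proof.
move=> [qq sq]; set z := x - q ** x.
have [->|z0] := eqVneq (nr z) 0; first exact: nr_ge0.
have z1 : 0 < nr z by rewrite lt_def z0 nr_ge0.
rewrite -(ler_pM2r z1) -expr2 -nr_sqr.
have -> : star z ** z = star x ** z.
  rewrite {1}/z starB starM sq amulBl.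
  have -> : star x ** q ** z = 0.
    by rewrite -amulA /z amulBr amulA qq subrr amul0r.
  by rewrite subr0.
by apply: le_trans (nrM _ _) _; rewrite nr_star.
Qed.

(** Up to the factor 1 + t, the inverse of 1 + t q is the convex combination of
    1 and 1 - q, both contractions. *)
Lemma accretive_projection q : projection q -> accretive q.
Proof.
move=> hq y t t0; have [qq sq] := hq; set z := y + _.
have t1 : 0 < 1 + t by lra.
have e : (1 + t)%:C *: y = z + t%:C *: (z - q ** z).
  have -> : z - q ** z = y - q ** y.
    rewrite /z amulDr amulZr amulA qq opprD addrACA.
    by rewrite subrr addr0.
  by rewrite scalerBr /z addrACA subrr addr0 rmorphD scalerDl scale1r.
have := congr1 (@nr _ _) e; rewrite nrZr gtr0_norm// => e'.
have := nrD z (t%:C *: (z - q ** z)); rewrite -e' nrZr ger0_norm//.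
have := projection_contr z hq.
move: (nr y) (nr z) (nr (_ - _)) => u v w h1 h2.
have : (1 + t) * u <= (1 + t) * v by nra.
by rewrite ler_pM2l.
Qed.

Lemma accretive_sum (I : Type) (s : seq I) (f : I -> A) :
  (forall i, projection (f i)) -> accretive (\sum_(i <- s) f i).
Proof.
move=> hf; elim: s => [|i s IH]; first by rewrite big_nil; exact: accretive0.
by rewrite big_cons; apply: accretiveD => //; exact: accretive_projection.
Qed.

(** For small s the norm of y^*(1 + s k)y is |(1 + (s/2) k)y|^2 up to order s^2,
    and convexity extends the inequality to all t. *)
Lemma accretive_form k y (t : R) : star k = k -> accretive k -> 0 <= t ->
  nr (star y ** y) <= nr (star y ** y + t%:C *: (star y ** (k ** y))).
Proof.
move=> sk hk; move: t; apply: (@convex_slope _ _ _ _ (nr (k ** y) ^+ 2)).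
  by rewrite exprn_ge0// nr_ge0.
move=> s s0; have s2 : 0 <= s / 2 by rewrite divr_ge0.
have := hk y (s / 2) s2; set w := k ** y => h.
have e : star (y + (s / 2)%:C *: w) ** (y + (s / 2)%:C *: w) =
    star y ** y + s%:C *: (star y ** w) + ((s / 2) ^+ 2)%:C *: (star w ** w).
  rewrite starD starZr amulDl !amulDr !amulZl !amulZr scalerA -rmorphM -expr2.
  have -> : star w ** y = star y ** w by rewrite starM sk amulA.
  by rewrite !addrA -[_ + _ + (s / 2)%:C *: _]addrA -scalerDl -rmorphD -splitr.
have := nrD (star y ** y + s%:C *: (star y ** w))
            (((s / 2) ^+ 2)%:C *: (star w ** w)).
rewrite -e !nr_sqr nrZr ger0_norm ?exprn_ge0// nr_sqr.
have := nr_ge0 y; have := nr_ge0 w.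
move: (nr (y + _)) (nr w) (nr y) (nr (star y ** y + _)) h => a b c d h b0 c0.
have a0 : 0 <= a by exact: le_trans h.
have : c ^+ 2 <= a ^+ 2 by rewrite lerXn2r ?nnegrE.
have : 0 <= (s * b) ^+ 2 by rewrite exprn_ge0// mulr_ge0.
rewrite !exprMn => h1 h2 h3; lra.
Qed.

End Accretive.

(** With a = 2 - 9 x^2 + 2 x^4 and b = 6 (x - x^3), it is the factorisation
    a^2 + b^2 = 4 x^8 + 17 x^4 + 4, multiplied by x.  The roots of a + ib are
    those of a^2 + b^2 in the upper half plane, as in the design of
    Butterworth filters. *)
Lemma butterworth_identity (S : comNzRingType) (x : S) :
  (2 - 9 * x ^+ 2 + 2 * x ^+ 4) * (2 - 9 * x ^+ 2 + 2 * x ^+ 4) * x +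
  (6 * x ^+ 1 - 6 * x ^+ 3) * (6 * x ^+ 1 - 6 * x ^+ 3) * x =
  4 * x ^+ 9 + (17 * x ^+ 5 + 4 * x ^+ 1).
Proof. by ring. Qed.

Section Polynomials.
Variables (R : realType) (A : cstarType R) (v : A).
Implicit Types (P Q : {poly R}).

(** The power of v with exponent n + 1: A need not have a unit, so exponents start at 1. *)
Definition pow1 n : A := iter n (amul v) v.

Lemma pow1M m n : pow1 m ** pow1 n = pow1 (m + n).+1.
Proof. by elim: m => [|m IH] //; rewrite addSn [pow1 m.+1]iterS -amulA IH. Qed.

Lemma nr_pow1 n : nr v <= 1 -> nr (pow1 n) <= 1.
Proof.
move=> v1; elim: n => [|n IH] //=; apply: le_trans (nrM _ _) _.
have := nr_ge0 v; have := nr_ge0 (pow1 n); rewrite -/(pow1 n); nra.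
Qed.

Lemma star_pow1 n : star v = v -> star (pow1 n) = pow1 n.
Proof.
move=> sv; elim: n => [|n IH] //=; rewrite starM -/(pow1 n) IH sv.
by rewrite -[X in _ ** X]/(pow1 0) pow1M addn0.
Qed.

(** The element v P(v).  The extra factor v avoids a constant term, at the price
    of the factor 'X in [pevalM]; it lets identities between elements of A be
    checked in the commutative ring of polynomials. *)
Definition peval (P : {poly R}) : A := \sum_(i < size P) (P`_i)%:C *: pow1 i.

Lemma pevalE n P : (size P <= n)%N -> peval P = \sum_(i < n) (P`_i)%:C *: pow1 i.
Proof.
move=> Pn; rewrite /peval (big_ord_widen n (fun i => (P`_i)%:C *: pow1 i))//.
rewrite big_mkcond; apply: eq_bigr => i _; case: ltnP => // h.
by rewrite nth_default// scale0r.
Qed.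

Lemma pevalD P Q : peval (P + Q) = peval P + peval Q.
Proof.
pose n := maxn (size P) (size Q).
rewrite (@pevalE n (P + Q)) ?size_polyD// (@pevalE n P) ?leq_maxl//.
rewrite (@pevalE n Q) ?leq_maxr// -big_split; apply: eq_bigr => i _.
by rewrite coefD rmorphD scalerDl.
Qed.

Lemma pevalZ c P : peval (c *: P) = c%:C *: peval P.
Proof.
rewrite (@pevalE (size P)) ?size_scale_leq// scaler_sumr.
by apply: eq_bigr => i _; rewrite coefZ rmorphM scalerA.
Qed.

Lemma pevalXn n : peval 'X^n = pow1 n.
Proof.
rewrite /peval size_polyXn big_ord_recr /= coefXn eqxx scale1r big1 ?add0r//.
by move=> i _; rewrite coefXn ltn_eqF// scale0r.
Qed.

Lemma peval0 : peval 0 = 0.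
Proof. by rewrite /peval size_poly0 big_ord0. Qed.

Lemma peval_sum (I : Type) (s : seq I) (F : I -> {poly R}) :
  peval (\sum_(i <- s) F i) = \sum_(i <- s) peval (F i).
Proof. exact: (big_morph _ pevalD peval0). Qed.

Lemma pevalM P Q : peval P ** peval Q = peval (P * Q * 'X).
Proof.
have suml (I : Type) (s : seq I) (F : I -> A) a :
    (\sum_(i <- s) F i) ** a = \sum_(i <- s) F i ** a.
  by apply: (big_morph (fun x => x ** a)) => [x y|]; rewrite ?amulDl ?amul0l.
have sumr (I : Type) (s : seq I) (F : I -> A) a :
    a ** (\sum_(i <- s) F i) = \sum_(i <- s) a ** F i.
  by apply: (big_morph (amul a)) => [x y|]; rewrite ?amulDr ?amul0r.
have -> : P * Q * 'X =
    \sum_(i < size P) \sum_(j < size Q) (P`_i * Q`_j) *: 'X^((i + j).+1).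
  rewrite -{1}(coefK P) -{1}(coefK Q) !poly_def mulr_suml mulr_suml.
  apply: eq_bigr => i _; rewrite mulr_sumr mulr_suml; apply: eq_bigr => j _.
  by rewrite -scalerAl -scalerAr scalerA -scalerAl -exprD -exprSr.
rewrite peval_sum suml; apply: eq_bigr => i _.
rewrite peval_sum sumr; apply: eq_bigr => j _.
by rewrite pevalZ pevalXn amulZl amulZr scalerA -rmorphM pow1M.
Qed.

Lemma star_peval P : star v = v -> star (peval P) = peval P.
Proof.
move=> sv; rewrite /peval (big_morph _ (@starD _ A) (@star0 _ A)).
by apply: eq_bigr => i _; rewrite starZr star_pow1.
Qed.

(** The functional calculus would bound v^2 - v^4 by 1/4.  A bound below 1 is all
    that [accretive_antisym] needs, and it follows from
    |b|^2 <= |a^2 + b^2| <= 4 + 17 + 4 = 25 with b = 6 (v^2 - v^4). *)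
Lemma butterworth : star v = v -> nr v <= 1 -> nr (pow1 1 - pow1 3) <= 5 / 6.
Proof.
move=> sv v1.
pose P : {poly R} := 2 - 9 * 'X^2 + 2 * 'X^4.
pose Q : {poly R} := 6 * 'X^1 - 6 * 'X^3.
have sc n (T : {poly R}) : (n%:R : R) *: T = n%:R * T.
  by rewrite scaler_nat mulr_natl.
have PQ : star (peval P) ** peval Q = star (peval Q) ** peval P.
  by rewrite !star_peval// !pevalM (mulrC P).
have := (nr_le_sum_sqr PQ).2; rewrite !star_peval// !pevalM -pevalD.
have -> : P * P * 'X + Q * Q * 'X =
    4%R *: 'X^9 + (17%R *: 'X^5 + 4%R *: 'X^1) :> {poly R}.
  by rewrite !sc /P /Q butterworth_identity.
have -> : peval Q = (6 : R)%:C *: (pow1 1 - pow1 3).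
  have -> : Q = 6%R *: 'X^1 + (- 6%R) *: 'X^3.
    by rewrite scaleNr !sc.
  by rewrite pevalD !pevalZ !pevalXn scalerBr rmorphN scaleNr.
rewrite !pevalD !pevalZ !pevalXn nrZr.
have := nrD ((4 : R)%:C *: pow1 9) ((17 : R)%:C *: pow1 5 + (4 : R)%:C *: pow1 1).
have := nrD ((17 : R)%:C *: pow1 5) ((4 : R)%:C *: pow1 1).
rewrite !nrZr !ger0_norm//.
have := nr_pow1 9 v1; have := nr_pow1 5 v1; have := nr_pow1 1 v1.
have := nr_ge0 (pow1 1 - pow1 3).
set u := nr (pow1 1 - pow1 3); set S := nr (_ + (_ + _)); set T := nr (_ + _).
move: (nr (pow1 1)) (nr (pow1 5)) (nr (pow1 9)) u S T => b c d u S T.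
move=> u0 h1 h2 h3 h4 h5 h6; clear sv PQ sc.
have : (6 * u) ^+ 2 <= 5 ^+ 2 by lra.
move=> /le_of_sqr h; have := h (ler0n R 5); lra.
Qed.

End Polynomials.

Section Positivity.
Variables (R : realType) (A : cstarType R).
Implicit Types (h y p q r z : A).

(** Here h and - h are both positive on the vectors killed by p.  After scaling
    to |h| = 1, the operators 1 + h and 1 - h do not decrease the norms of such
    vectors, and h^2 is one of them; so 1 = |h^2| <= |(1 - h)(1 + h) h^2|, which
    is |h^2 - h^4|, against [butterworth]. *)
Lemma accretive_antisym p h : star h = h -> p ** h = 0 ->
  (forall y (t : R), p ** y = 0 -> nr y <= nr (y + t%:C *: (h ** y))) -> h = 0.
Proof.
move=> sh ph hh; apply: nr0_eq0; apply/eqP; apply/contraT => l0.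
have lp : 0 < nr h by rewrite lt_def l0 nr_ge0.
pose l := (nr h)^-1; pose v := l%:C *: h.
have sv : star v = v by rewrite /v starZr sh.
have nv : nr v = 1 by rewrite /v nrZr gtr0_norm ?invr_gt0// mulVf.
have pv n : p ** pow1 v n = 0.
  by case: n => [|n]; rewrite /= ?amulA /v amulZr ph ?scaler0 ?amul0l.
have vE (y : A) t : t%:C *: (v ** y) = (t * l)%:C *: (h ** y).
  by rewrite /v amulZl scalerA -rmorphM.
have hv y (t : R) : p ** y = 0 -> nr y <= nr (y + t%:C *: (v ** y)).
  by move=> py; rewrite vE; exact: hh.
have h1 : nr (pow1 v 1) <= nr (pow1 v 1 + pow1 v 2).
  by have := hv (pow1 v 1) 1 (pv 1); rewrite rmorph1 scale1r.
have h2 : nr (pow1 v 1 + pow1 v 2) <= nr (pow1 v 1 - pow1 v 3).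
  have py : p ** (pow1 v 1 + pow1 v 2) = 0 by rewrite amulDr !pv addr0.
  have := hv _ (-1) py; rewrite rmorphN1 scaleN1r amulDr.
  have -> : v ** pow1 v 1 + v ** pow1 v 2 = pow1 v 2 + pow1 v 3 by [].
  by rewrite opprD addrA addrK.
have n1 : nr (pow1 v 1) = 1 by rewrite /= nr_sqr_self// nv expr1n.
have h3 := @butterworth _ _ v sv _; rewrite nv lexx in h3.
have := h3 isT; rewrite n1 in h1; lra.
Qed.

(** If p y = 0 then q y = - r y, and both q and r are positive.  So the compression
    of q to the range of 1 - p, which is z z^* for z = (1 - p) q, is positive
    together with its opposite, and vanishes by [accretive_antisym]. *)
Lemma projection_absorb q r : projection q -> star r = r -> accretive r ->
  projection (q + r) -> (q + r) ** q = q.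
Proof.
move=> [qq sq] sr ar; set p := q + r => -[pp sp].
have aq : accretive q by apply: accretive_projection; split.
pose z := q - p ** q; pose h := z ** star z.
have pz : p ** z = 0 by rewrite /z amulBr amulA pp subrr.
have h0 : h = 0.
  apply: (@accretive_antisym p); rewrite /h ?starM ?starK ?amulA ?pz ?amul0l//.
  move=> y t py.
  have yp : star y ** p = 0.
    by rewrite -(starK (star y ** p)) starM starK sp py star0.
  have hy : h ** y = q ** y - p ** (q ** y).
    have zy : star z ** y = q ** y.
      by rewrite /z starB starM sp sq amulBl -amulA py amul0r subr0.
    by rewrite /h -amulA zy /z amulBl -(amulA p q) amulA qq.
  have yhy : star y ** (h ** y) = star y ** (q ** y).
    by rewrite hy amulBr [X in _ - X]amulA yp amul0l subr0.
  have [->|y0] := eqVneq (nr y) 0; first exact: nr_ge0.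
  have y1 : 0 < nr y by rewrite lt_def y0 nr_ge0.
  have e : nr (star y ** y) <= nr (star y ** y + t%:C *: (star y ** (h ** y))).
    rewrite yhy; have [t0|t0] := leP 0 t; first exact: accretive_form.
    have -> : q ** y = - (r ** y).
      by apply/eqP; rewrite -addr_eq0 -amulDl py.
    rewrite amulNr scalerN -scaleNr -rmorphN.
    by apply: accretive_form => //; rewrite oppr_ge0 ltW.
  rewrite -amulZr -amulDr nr_sqr in e; have := le_trans e (nrM _ _).
  by rewrite nr_star expr2 ler_pM2l.
have : star z = 0.
  apply: nr0_eq0; apply/eqP; rewrite -sqrf_eq0 -nr_sqr starK -/h h0 nr0//.
move=> /(congr1 (@star _ _)); rewrite starK star0 /z => /eqP.
by rewrite subr_eq0 => /eqP.
Qed.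

Lemma star_sum (I : Type) (l : seq I) (f : I -> A) :
  (forall i, star (f i) = f i) -> star (\sum_(i <- l) f i) = \sum_(i <- l) f i.
Proof.
move=> hf; rewrite (big_morph _ (@starD _ A) (@star0 _ A)).
exact: eq_bigr.
Qed.

Section SumOfProjections.
Variables (I : eqType) (f : I -> A).
Hypothesis hf : forall i, projection (f i).

Lemma sum_projection_absorb (l : seq I) i :
  projection (\sum_(j <- l) f j) -> i \in l -> (\sum_(j <- l) f j) ** f i = f i.
Proof.
move=> hl il; rewrite (big_rem i il) /= in hl *.
apply: projection_absorb => //; last exact: accretive_sum.
by apply: star_sum => j; case: (hf j).
Qed.

(** The remaining projections sum to p - f i, which is again a projection; it
    absorbs f j and is orthogonal to f i. *)
Lemma sum_projection_orthogonal (l : seq I) i j :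
  projection (\sum_(k <- l) f k) -> uniq l -> i \in l -> j \in l -> i != j ->
  f i ** f j = 0.
Proof.
move=> hl ul il jl ij; have hp := sum_projection_absorb hl il.
have hp' : f i ** (\sum_(k <- l) f k) = f i.
  by rewrite -{1}(hf i).2 -hl.2 -starM hp (hf i).2.
have jr : j \in rem i l by rewrite mem_rem_uniq// !inE eq_sym ij.
have e : \sum_(k <- rem i l) f k = \sum_(k <- l) f k - f i.
  by rewrite (big_rem i il) /= addrAC subrr add0r.
have hr : projection (\sum_(k <- rem i l) f k).
  rewrite e; split; last by rewrite starB hl.2 (hf i).2.
  by rewrite amulBl !amulBr hl.1 hp hp' (hf i).1 subrr subr0.
by rewrite -(sum_projection_absorb hr jr) e amulA amulBr hp' (hf i).1 subrr amul0l.
Qed.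

End SumOfProjections.

End Positivity.

(** * The quotient C*-algebra *)

Section Quotient.
Variables (R : realType) (A : cstarType R) (I : set A).

(** The proof that I is an ideal is a parameter, so that the closure instances can
    be attached to this predicate. *)
Definition ideal_mem of closed_ideal I : {pred A} := fun a => `[< I a >].

Hypothesis hI : closed_ideal I.

Fact ideal_mem_zmod_closed : zmod_closed (ideal_mem hI).
Proof.
split; first by apply/asboolP; exact: ideal0.
by move=> a b /asboolP Ia /asboolP Ib; apply/asboolP; exact: idealB.
Qed.

HB.instance Definition _ :=
  GRing.isZmodClosed.Build A (ideal_mem hI) ideal_mem_zmod_closed.

Definition cquot := @Quotient.quot A (ideal_mem hI).
HB.instance Definition _ := GRing.Zmodule.on cquot.

Definition cls (a : A) : cquot := (\pi_cquot a)%qT.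

Implicit Types (a b : A) (x y z : cquot).

Lemma clsP a b : cls a = cls b <-> I (a - b).
Proof.
split=> [/eqP|h].
  by rewrite -Quotient.idealrBE => /asboolP.
by apply/eqP; rewrite -Quotient.idealrBE; apply/asboolP.
Qed.

Lemma cls_surj x : exists a, cls a = x.
Proof. by exists (repr x); exact: reprK. Qed.

Lemma clsD a b : cls (a + b) = cls a + cls b.
Proof. exact: raddfD. Qed.

Lemma clsB a b : cls (a - b) = cls a - cls b.
Proof. exact: raddfB. Qed.

Lemma cls0 : cls 0 = 0.
Proof. exact: raddf0. Qed.

Lemma cls_eq0 a : cls a = 0 <-> I a.
Proof. by rewrite -cls0 clsP subr0. Qed.

Let rep x : A := repr x.
Let repK x : cls (rep x) = x. Proof. exact: reprK. Qed.
Let rep_cls a : I (rep (cls a) - a). Proof. by apply/clsP; rewrite repK. Qed.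

Definition qscale (c : R[i]) x : cquot := cls (c *: rep x).

Lemma cls_scale c a : qscale c (cls a) = cls (c *: a).
Proof. by apply/clsP; rewrite -scalerBr; exact: idealZ. Qed.

Fact qscaleA c d x : qscale c (qscale d x) = qscale (c * d) x.
Proof. by have [a <-] := cls_surj x; rewrite !cls_scale scalerA. Qed.

Fact qscale1 : left_id 1 qscale.
Proof. by move=> x; have [a <-] := cls_surj x; rewrite cls_scale scale1r. Qed.

Fact qscaleDr : right_distributive qscale +%R.
Proof.
move=> c x y; have [a <-] := cls_surj x; have [b <-] := cls_surj y.
by rewrite -clsD !cls_scale -clsD scalerDr.
Qed.

Fact qscaleDl x c d : qscale (c + d) x = qscale c x + qscale d x.
Proof. by have [a <-] := cls_surj x; rewrite !cls_scale -clsD scalerDl. Qed.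

HB.instance Definition _ := GRing.Zmodule_isLmodule.Build R[i] cquot
  qscaleA qscale1 qscaleDr qscaleDl.

Lemma clsZ (c : R[i]) a : cls (c *: a) = c *: cls a.
Proof. by rewrite -cls_scale. Qed.

Definition qnorm x : R := inf [set nr a | a in [set a | cls a = x]].

Let has_inf_qnorm x : has_inf [set nr a | a in [set a | cls a = x]].
Proof.
split; first by have [a ax] := cls_surj x; exists (nr a), a.
by exists 0 => _ [a _ <-]; exact: nr_ge0.
Qed.

Lemma qnorm_le a : qnorm (cls a) <= nr a.
Proof. by apply: ge_inf; [exact: (has_inf_qnorm _).2|exists a]. Qed.

Lemma qnorm_lift x (e : R) : 0 < e -> exists2 a, cls a = x & nr a < qnorm x + e.
Proof.
by move=> e0; have [_ [a ax <-] h] := inf_adherent e0 (has_inf_qnorm x); exists a.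
Qed.

Lemma qnorm_ge0 x : 0 <= qnorm x.
Proof.
apply/ler_addgt0Pr => e e0; have [a _] := qnorm_lift x e0.
by move=> /ltW; apply: le_trans; exact: nr_ge0.
Qed.

Fact qnormD x y : (qnorm (x + y))%:C <= (qnorm x)%:C + (qnorm y)%:C.
Proof.
rewrite -rmorphD lecR; apply/ler_addgt0Pr => e e0.
have e20 : 0 < e / 2 by rewrite divr_gt0.
have [a <- ha] := qnorm_lift x e20; have [b <- hb] := qnorm_lift y e20.
rewrite -clsD; apply: le_trans (qnorm_le _) _.
have := nrD a b; lra.
Qed.

Let normc_real (c : R[i]) : `|c| = (complex.Re `|c|)%:C.
Proof. by rewrite RRe_real// ger0_real. Qed.

Fact qnormZ c x : (qnorm (c *: x))%:C = `|c| * (qnorm x)%:C.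
Proof.
have le d y : qnorm (d *: y) <= complex.Re `|d| * qnorm y.
  have d0 : 0 <= complex.Re `|d| by rewrite -ler0c -normc_real.
  apply/ler_addgt0Pr => e e0.
  have e1 : 0 < e / (complex.Re `|d| + 1) by rewrite divr_gt0// ltr_wpDl.
  have [a <- ha] := qnorm_lift y e1; rewrite -clsZ.
  apply: le_trans (qnorm_le _) _; rewrite nrZ.
  apply: le_trans (ler_wpM2l d0 (ltW ha)) _; rewrite mulrDr lerD2l.
  by rewrite mulrA ler_pdivrMr ?ltr_wpDl// mulrC ler_pM2l//; lra.
rewrite normc_real -rmorphM; congr (_%:C); apply/eqP; rewrite eq_le le andTb.
have [->|c0] := eqVneq c 0; first by rewrite normr0 mul0r qnorm_ge0.
have cp : 0 < complex.Re `|c| by rewrite -ltcR -normc_real normr_gt0.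
have := le c^-1 (c *: x); rewrite scalerA mulVf// scale1r => h.
have e : complex.Re `|c^-1| = (complex.Re `|c|)^-1.
  have := normc_real c^-1.
  by rewrite normfV [X in X^-1 = _]normc_real -fmorphV => /complexI <-.
by rewrite -ler_pdivlMl// -e.
Qed.

Fact qnorm0_eq0 x : (qnorm x)%:C = 0 -> x = 0.
Proof.
move=> /complexI h; have [a ax] := cls_surj x; rewrite -ax; apply/cls_eq0.
have /closed_limP := ideal_closed hI; apply => e e0.
have [b bx hb] := qnorm_lift x e0.
exists (a - b); first by apply/clsP; rewrite ax bx.
by rewrite opprB addrC subrK; rewrite h add0r in hb.
Qed.

HB.instance Definition _ := Lmodule_isNormed.Build R[i] cquot
  qnormD qnormZ qnorm0_eq0.

Lemma normr_cquot x : `|x| = (qnorm x)%:C. Proof. by []. Qed.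

(** A Cauchy filter is close to a sequence of classes with geometrically small
    increments; lifting the increments one by one gives a convergent series
    in A. *)
Fact cquot_complete (F : set_system cquot) :
  ProperFilter F -> cauchy F -> cvg F.
Proof.
move=> FF /cauchyP Fc.
pose h n : R := 2^-1 ^+ n.
have h0 n : 0 < h n by rewrite exprn_gt0// invr_gt0.
have hS n : h n.+1 = h n / 2 by rewrite /h exprSr.
have [xs Fxs] : {xs : nat -> cquot & forall n, F (ball (xs n) (h n)%:C)}.
  apply: (@choice _ _ (fun n x => F (ball x (h n)%:C))) => n.
  by apply: Fc; rewrite ltcR.
have ballE x y (e : R) : ball x e%:C y <-> qnorm (x - y) < e.
  by rewrite -ball_normE /ball_/= normr_cquot ltcR.
have xsS n : qnorm (xs n.+1 - xs n) < 2 * h n.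
  have [y [/ballE h1 /ballE h2]] := filter_ex (filterI (Fxs n) (Fxs n.+1)).
  have := qnormD (xs n.+1 - y) (y - xs n); rewrite addrA subrK -rmorphD lecR.
  have -> : qnorm (y - xs n) = qnorm (xs n - y).
    by apply/complexI; rewrite -!normr_cquot distrC.
  have := hS n; have := h0 n; lra.
have [d hd] : {d : nat -> A & forall n,
    cls (d n) = xs n.+1 - xs n /\ nr (d n) <= 3 * h n}.
  apply: (@choice _ _ (fun n a => cls a = xs n.+1 - xs n /\ nr a <= 3 * h n)) => n.
  have [a ax ha] := qnorm_lift (xs n.+1 - xs n) (h0 n).
  by exists a; split => //; have := xsS n; lra.
have [a0 ha0] := cls_surj (xs 0%N).
pose a n := a0 + \sum_(i < n) d i.
have aS n : a n.+1 - a n = d n.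
  by rewrite /a big_ord_recr /= addrA addrC addrK.
have ha n : cls (a n) = xs n.
  elim: n => [|n IH]; first by rewrite /a big_ord0 addr0.
  by rewrite -(subrK (a n) (a n.+1)) aS clsD IH (hd n).1 subrK.
have q01 : 0 <= (2^-1 : R) < 1 by lra.
have [|l hl] := @geometric_cvg _ _ a 3 2^-1 q01.
  by move=> n; rewrite aS; exact: (hd n).2.
have hl' n : qnorm (cls l - xs n) <= 6 * h n.
  rewrite -ha -clsB; apply: le_trans (qnorm_le _) _.
  apply: le_trans (hl n) _; rewrite le_eqVlt; apply/orP; left; apply/eqP.
  by congr (_ * _); field.
apply/cvg_ex; exists (cls l); apply/cvg_ballP => e e0.
have er : e = (complex.Re e)%:C by rewrite RRe_real// gtr0_real.
have e0' : 0 < complex.Re e by rewrite -ltcR -er.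
have [N /(_ N (leqnn _)) hN] := geometric_small 7 q01 e0'.
apply: filterS (Fxs N) => y /ballE yN; rewrite er; apply/ballE.
have := qnormD (cls l - xs N) (xs N - y); rewrite addrA subrK -rmorphD lecR.
have := hl' N; rewrite -/(h N) in hN; lra.
Qed.

HB.instance Definition _ := Uniform_isComplete.Build cquot cquot_complete.

Definition qmul x y : cquot := cls (repr x ** repr y).

Definition qstar x : cquot := cls (star (repr x)).

Lemma cls_mul a b : qmul (cls a) (cls b) = cls (a ** b).
Proof.
apply/clsP; have ha := rep_cls a; have hb := rep_cls b.
rewrite -(subrK (repr (cls a) ** b) (_ ** _)) -amulBr -addrA -amulBl.
by apply: (idealD hI); [exact: (ideal_mull hI)|exact: (ideal_mulr hI)].
Qed.

Lemma cls_star a : qstar (cls a) = cls (star a).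
Proof. by apply/clsP; rewrite -starB; exact: ideal_star. Qed.

Fact qmulA : associative qmul.
Proof.
move=> x y z; have [a <-] := cls_surj x; have [b <-] := cls_surj y.
by have [c <-] := cls_surj z; rewrite !cls_mul amulA.
Qed.

Fact qmulDl : left_distributive qmul +%R.
Proof.
move=> x y z; have [a <-] := cls_surj x; have [b <-] := cls_surj y.
by have [c <-] := cls_surj z; rewrite -clsD !cls_mul -clsD amulDl.
Qed.

Fact qmulDr : right_distributive qmul +%R.
Proof.
move=> x y z; have [a <-] := cls_surj x; have [b <-] := cls_surj y.
by have [c <-] := cls_surj z; rewrite -clsD !cls_mul -clsD amulDr.
Qed.

Fact qmulZl (c : R[i]) x y : qmul (c *: x) y = c *: qmul x y.
Proof.
have [a <-] := cls_surj x; have [b <-] := cls_surj y.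
by rewrite -clsZ !cls_mul -clsZ amulZl.
Qed.

Fact qmulZr (c : R[i]) x y : qmul x (c *: y) = c *: qmul x y.
Proof.
have [a <-] := cls_surj x; have [b <-] := cls_surj y.
by rewrite -clsZ !cls_mul -clsZ amulZr.
Qed.

Fact qstarK : involutive qstar.
Proof. by move=> x; have [a <-] := cls_surj x; rewrite !cls_star starK. Qed.

Fact qstarD : {morph qstar : x y / x + y}.
Proof.
move=> x y; have [a <-] := cls_surj x; have [b <-] := cls_surj y.
by rewrite -clsD !cls_star -clsD starD.
Qed.

Fact qstarZ (c : R[i]) x : qstar (c *: x) = conjc c *: qstar x.
Proof.
by have [a <-] := cls_surj x; rewrite -clsZ !cls_star -clsZ starZ.
Qed.

Fact qstarM x y : qstar (qmul x y) = qmul (qstar y) (qstar x).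
Proof.
have [a <-] := cls_surj x; have [b <-] := cls_surj y.
by rewrite !(cls_mul, cls_star) starM.
Qed.

Let qnormM x y : qnorm (qmul x y) <= qnorm x * qnorm y.
Proof.
have x0 := qnorm_ge0 x; have y0 := qnorm_ge0 y.
apply/ler_addgt0Pr => e e0.
pose d := Num.min 1 (e / (qnorm x + qnorm y + 1)).
have s0 : 0 < qnorm x + qnorm y + 1 by rewrite ltr_wpDl// addr_ge0.
have d0 : 0 < d by rewrite lt_min ltr01 divr_gt0.
have d1 : d <= 1 by rewrite ge_min lexx.
have de : d * (qnorm x + qnorm y + 1) <= e.
  by rewrite -ler_pdivlMr// ge_min lexx orbT.
have [a ax ha] := qnorm_lift x d0; have [b bx hb] := qnorm_lift y d0.
rewrite -[X in qmul X]ax -[X in qmul _ X]bx cls_mul.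
apply: le_trans (qnorm_le _) _; apply: le_trans (nrM _ _) _.
have := nr_ge0 a; have := nr_ge0 b; move: ha hb.
move: (nr a) (nr b) (qnorm x) (qnorm y) x0 y0 de => u v w z w0 z0.
clear -R d0 d1 => h1 h2 h3 h4 h5.
have : u * v <= (w + d) * (z + d) by apply: ler_pM => //; exact: ltW.
nra.
Qed.

Fact normr_qmul_le x y : `|qmul x y| <= `|x| * `|y|.
Proof. by rewrite !normr_cquot -rmorphM lecR. Qed.

(** One inequality is submultiplicativity and the other is
    [quotient_norm_sqr]. *)
Fact normr_qstar_mul x : `|qmul (qstar x) x| = `|x| ^+ 2.
Proof.
rewrite !normr_cquot -rmorphXn; congr (_%:C); apply/eqP; rewrite eq_le.
apply/andP; split.
  apply: le_trans (qnormM _ _) _; rewrite expr2.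
  apply: ler_wpM2r; first exact: qnorm_ge0.
  apply/ler_addgt0Pr => e e0; have [a ax ha] := qnorm_lift x e0.
  rewrite -[X in qstar X]ax cls_star; apply: le_trans (qnorm_le _) _.
  by rewrite nr_star ltW.
apply/ler_addgt0Pr => e e0; have [a ax] := cls_surj x.
have e20 : 0 < e / 2 by rewrite divr_gt0.
have [c cx hc] := qnorm_lift (qmul (qstar x) x) e20.
have Ij : I (c - star a ** a).
  by apply/clsP; rewrite cx -ax cls_star cls_mul.
have [k Ik hk] := quotient_norm_sqr hI a Ij e20.
rewrite [_ + (c - _)]addrC subrK in hk.
have xk : x = cls (a + k).
  by rewrite -ax; apply/clsP; rewrite opprD addrA subrr add0r; exact: idealN.
have h1 : qnorm x <= nr (a + k) by rewrite xk qnorm_le.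
have h2 := qnorm_ge0 x.
have h3 : qnorm x ^+ 2 <= nr (a + k) ^+ 2 by rewrite lerXn2r ?nnegrE ?nr_ge0.
lra.
Qed.

HB.instance Definition _ := isCStarAlgebra.Build R cquot
  qmulA qmulDl qmulDr qmulZl qmulZr qstarK qstarD qstarZ qstarM
  normr_qmul_le normr_qstar_mul.

Definition cstar_quotient : cstarType R := cquot.

Lemma clsM a b : cls (a ** b) = (cls a : cstar_quotient) ** cls b.
Proof. by rewrite -cls_mul. Qed.

Lemma cls_starE a : cls (star a) = star (cls a : cstar_quotient).
Proof. by rewrite -cls_star. Qed.

Lemma nr_cls a : nr (cls a : cstar_quotient) <= nr a.
Proof. exact: qnorm_le. Qed.

End Quotient.

(** * Relations of a Cuntz-Krieger family *)

Section Relations.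
Variables (R : realType) (E : digraph) (A : cstarType R).
Variables (p : vertex E -> A) (s : edge E -> A).
Hypotheses (hE : row_finite E) (hCK : CK_family p s).
Implicit Types (v w : vertex E) (e f : edge E) (l : seq (edge E)).

Lemma family_idem v : p v ** p v = p v.
Proof. by case: hCK => -[/(_ v)[]]. Qed.

Lemma family_star v : star (p v) = p v.
Proof. by case: hCK => -[/(_ v)[]]. Qed.

Lemma family_orth v w : v <> w -> p v ** p w = 0.
Proof. by case: hCK => -[_ h _ _] _; exact: h. Qed.

Lemma family_iso e : star (s e) ** s e = p (src e).
Proof. by case: hCK => -[]. Qed.

Lemma edge_src e : s e ** p (src e) = s e.
Proof.
apply/eqP; rewrite eq_sym -subr_eq0; apply/eqP/nr0_eq0/eqP.
rewrite -sqrf_eq0 -nr_sqr starB starM family_star amulBl !amulBr.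
rewrite -!amulA (amulA (star (s e))) family_iso !family_idem !subrr nr0 //.
Qed.

Lemma edge_proj e : projection (s e ** star (s e)).
Proof.
split; last by rewrite starM starK.
by rewrite amulA -(amulA (s e)) family_iso edge_src.
Qed.

Lemma vertex_sum e :
  p (rng e) = \sum_(f <- fset_set (edges_to (rng e))) s f ** star (s f).
Proof.
have fin : finite_set (edges_to (rng e)) := hE (rng e).
have ne : edges_to (rng e) !=set0 by exists e.
by case: hCK => _ /(_ _ ne fin) ->; rewrite fsbig_finite.
Qed.

Let edge_mem e f : rng f = rng e -> f \in (fset_set (edges_to (rng e)) : seq _).
Proof. by move=> fe; rewrite (in_fset_set (hE (rng e))); apply/mem_set. Qed.

(** The projections s_f s_f^* with f in r(e)E^1 sum to p_{r(e)}, which therefore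
    absorbs s_e s_e^*. *)
Lemma edge_rng e : p (rng e) ** s e = s e.
Proof.
have h : p (rng e) ** (s e ** star (s e)) = s e ** star (s e).
  have hp : projection (p (rng e)) by split; rewrite ?family_idem ?family_star.
  rewrite vertex_sum in hp *; apply: (sum_projection_absorb edge_proj) => //.
  exact: edge_mem.
by rewrite -{1}edge_src -family_iso !amulA -(amulA (p _)) h -amulA family_iso edge_src.
Qed.

Lemma edge_orth e f : e <> f -> star (s e) ** s f = 0.
Proof.
move=> ef.
have starE : star (s e) = star (s e) ** p (rng e).
  by rewrite -{1}edge_rng starM family_star.
have [fe|fe] := pselect (rng f = rng e); last first.
  rewrite starE -(edge_rng f) amulA -(amulA (star (s e))) family_orth.
    by rewrite amul0r amul0l.
  by move=> h; apply: fe.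
have hp : projection (p (rng e)) by split; rewrite ?family_idem ?family_star.
rewrite vertex_sum in hp.
have h := sum_projection_orthogonal edge_proj hp (fset_uniq _)
  (edge_mem erefl) (edge_mem fe) (introN eqP ef).
have -> : star (s e) = star (s e) ** (s e ** star (s e)).
  by rewrite amulA family_iso -{1}edge_src starM family_star.
have -> : s f = s f ** star (s f) ** s f by rewrite -amulA family_iso edge_src.
by rewrite -amulA (amulA (s e ** _)) h amul0l amul0r.
Qed.

Lemma nr_vertex v : p v <> 0 -> nr (p v) = 1.
Proof.
move=> pv; have n0 : nr (p v) != 0 by apply/eqP => /nr0_eq0.
have := nr_sqr (p v); rewrite family_star family_idem expr2 => h.
by apply: (mulfI n0); rewrite -h mulr1.
Qed.

End Relations.

Section NullSequences.
Variables (R : realType) (A : cstarType R).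
Implicit Types (x y z : nat -> A).

Definition null_seq x : Prop :=
  forall e : R, 0 < e -> exists N, forall n, (N <= n)%N -> nr (x n) < e.

Lemma null_seq0 : null_seq (fun=> 0).
Proof. by move=> e e0; exists 0%N => n _; rewrite nr0. Qed.

Lemma eq_null_seq y x : (forall n, x n = y n) -> null_seq y -> null_seq x.
Proof. by move=> /funext ->. Qed.

Lemma null_seqD x y : null_seq x -> null_seq y -> null_seq (fun n => x n + y n).
Proof.
move=> hx hy e e0; have e2 : 0 < e / 2 by rewrite divr_gt0.
have [N hN] := hx _ e2; have [M hM] := hy _ e2.
exists (maxn N M) => n; rewrite geq_max => /andP[Nn Mn].
have := hN n Nn; have := hM n Mn; have := nrD (x n) (y n); lra.
Qed.

Lemma null_seq_le (C : R) x y :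
  (forall n, nr (y n) <= C * nr (x n)) -> null_seq x -> null_seq y.
Proof.
move=> h hx e e0; have C1 : 0 < `|C| + 1 by rewrite ltr_wpDl.
have [N hN] := hx _ (divr_gt0 e0 C1); exists N => n Nn.
apply: le_lt_trans (h n) _; have := hN n Nn; rewrite ltr_pdivlMr// => hn.
have := nr_ge0 (x n); have := ler_norm C; nra.
Qed.

Lemma null_seqZ (c : R[i]) x : null_seq x -> null_seq (fun n => c *: x n).
Proof. by apply: null_seq_le => n; rewrite nrZ. Qed.

Lemma null_seqMl (a : A) x : null_seq x -> null_seq (fun n => a ** x n).
Proof. by apply: null_seq_le => n; exact: nrM. Qed.

Lemma null_seqS x : null_seq (fun n => x n.+1) -> null_seq x.
Proof.
by move=> h e /h[N hN]; exists N.+1 => -[|n] // Nn; exact: hN.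
Qed.

Lemma null_seq_closed (x : A -> nat -> A) (C : R) :
  (forall a b n, nr (x a n - x b n) <= C * nr (a - b)) ->
  closed [set a | null_seq (x a)].
Proof.
move=> hx; apply/closed_limP => l hl e e0.
have C1 : 0 < `|C| + 1 by rewrite ltr_wpDl.
have e2 : 0 < e / 2 by rewrite divr_gt0.
have [a /= ha la] := hl _ (divr_gt0 e2 C1); have [N hN] := ha _ e2.
exists N => n Nn; rewrite ltr_pdivlMr// in la.
have := hx l a n; have := hN n Nn; have := nr_subl (x l n) (x a n).
have := nr_ge0 (l - a); have := ler_norm C; nra.
Qed.

End NullSequences.

(** * An ideal that does not see a boundary path *)

Section Generation.
Variables (R : realType) (A : cstarType R).

Lemma cstar_gen_subalgebra (G : set A) : cstar_subalgebra (cstar_gen G).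
Proof.
split.
- by apply: closed_bigI => S [[]].
- by move=> S [[]].
- move=> c a b ha hb S hS; case: (hS) => -[_ _ h _ _] _.
  by apply: h; [exact: ha|exact: hb].
- move=> a b ha hb S hS; case: (hS) => -[_ _ _ h _] _.
  by apply: h; [exact: ha|exact: hb].
- by move=> a ha S hS; case: (hS) => -[_ _ _ _ h] _; apply: h; exact: ha.
Qed.

Lemma cstar_gen_sub (G S : set A) :
  cstar_subalgebra S -> G `<=` S -> cstar_gen G `<=` S.
Proof. by move=> hS GS a; apply; split. Qed.

Lemma cstar_gen_incl (G : set A) : G `<=` cstar_gen G.
Proof. by move=> a Ga S [_]; apply. Qed.

End Generation.

Lemma connects_refl (E : digraph) (v : vertex E) : connects v v.
Proof. by exists [::]. Qed.

Lemma connects_edge (E : digraph) (e : edge E) (w : vertex E) :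
  connects (src e) w -> connects (rng e) w.
Proof.
case=> l hl <-; exists (e :: l); last by [].
by case: l hl => [|f l] /=; rewrite eqxx //= /composable eq_sym.
Qed.

(** The element xi k m stands for s_{x_{k+1}...x_{k+m}}, where x is a boundary
    path with vertices xv k.  For a finite path only its last vertex matters, and
    xi is constantly the projection there; the alternatives of [xi_shift] cover
    both cases. *)
Section TailIdeal.
Variables (R : realType) (E : digraph) (A : cstarType R).
Variables (p : vertex E -> A) (s : edge E -> A).
Hypotheses (hE : row_finite E) (hCK : CK_family p s).
Hypotheses (hgen : family_cstar p s = setT) (hp : forall v, p v <> 0).
Variables (xv : nat -> vertex E) (xi : nat -> nat -> A) (v : vertex E).
Hypothesis xi_rng : forall k m, p (xv k) ** xi k m = xi k m.
Hypothesis xi_shift : forall k e, (forall m, star (s e) ** xi k m.+1 = 0) \/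
  (forall m, star (s e) ** xi k m.+1 = xi k.+1 m).
Hypothesis nr_xi : forall k m, nr (xi k m) = 1.
Hypothesis unreached : forall k, ~ connects v (xv k).
Implicit Types (u : vertex E) (e f : edge E) (l : seq (edge E)) (k m : nat).
Implicit Types (a b c d : A).

Let tail l k m := foldr (fun e a => s e ** a) (xi k m) l.

Let vertex_tail u l k : (forall m, p u ** tail l k m = 0) \/
  (forall m, p u ** tail l k m = tail l k m).
Proof.
case: l => [|e l].
  have [->|h] := pselect (u = xv k); first by right=> m; exact: xi_rng.
  by left=> m; rewrite /= -xi_rng amulA (family_orth hCK)// amul0l.
have [->|h] := pselect (u = rng e).
  by right=> m; rewrite /= amulA edge_rng.
by left=> m; rewrite /= -(edge_rng hE hCK) !amulA (family_orth hCK)// !amul0l.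
Qed.

Let vertex_tail0 u l k m : ~ connects u (xv k) -> p u ** tail l k m = 0.
Proof.
elim: l u => [|e l IH] u hu /=.
  rewrite -xi_rng amulA (family_orth hCK) ?amul0l// => h.
  by apply: hu; rewrite h; exact: connects_refl.
have [ue|ue] := pselect (u = rng e); last first.
  by rewrite -(edge_rng hE hCK) !amulA (family_orth hCK)// !amul0l.
rewrite -(edge_src hCK) -amulA IH ?amul0r// => h.
by apply: hu; rewrite ue; exact: connects_edge.
Qed.

Let nr_edge e : nr (s e) <= 1.
Proof.
apply: le_of_sqr => //.
by rewrite -nr_sqr (family_iso hCK) (nr_vertex hCK (@hp _)) expr1n.
Qed.

Let nr_tail l k m : nr (tail l k m) <= 1.
Proof.
elim: l => [|e l IH] /=; first by rewrite nr_xi.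
apply: le_trans (nrM _ _) _; have := nr_edge e; have := nr_ge0 (s e).
have := nr_ge0 (tail l k m); rewrite /tail in IH *; nra.
Qed.

(** Heuristically, d carries every path with the same tail as x to a vector
    orthogonal to the range of p_v. *)
Let vanishing d := forall l k, null_seq (fun m => p v ** (d ** tail l k m)).

Let vanishing_closed : closed vanishing.
Proof.
apply/closed_limP => d hd l k.
suff : closed [set d | null_seq (fun m => p v ** (d ** tail l k m))].
  move=> /closed_limP; apply => e /hd[a ha da]; exists a => //; exact: ha.
apply: (@null_seq_closed _ _ _ (nr (p v))) => a b n.
rewrite -amulBr -amulBl; apply: le_trans (nrM _ _) _.
apply: ler_wpM2l; first exact: nr_ge0.
apply: le_trans (nrM _ _) _; rewrite -[leRHS]mulr1.
by apply: ler_wpM2l; [exact: nr_ge0|exact: nr_tail].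
Qed.

Let vanishing0 : vanishing 0.
Proof.
move=> l k e e0; exists 0%N => n _.
by rewrite amul0l amul0r nr0.
Qed.

Let vanishingD (c : R[i]) a b :
  vanishing a -> vanishing b -> vanishing (c *: a + b).
Proof.
move=> ha hb l k.
apply: (@eq_null_seq _ _ (fun m => c *: (p v ** (a ** tail l k m)) +
    p v ** (b ** tail l k m))) => [m|].
  by rewrite amulDl amulDr amulZl amulZr.
by apply: null_seqD; [apply: null_seqZ; exact: ha|exact: hb].
Qed.

(** Right multiplication by such a g preserves [vanishing].  The index m.+1 occurs
    because s_e^* removes the first edge of a tail. *)
Let good g := forall l k, (forall m, g ** tail l k m.+1 = 0) \/
  exists l' k', (forall m, g ** tail l k m.+1 = tail l' k' m) \/
                (forall m, g ** tail l k m.+1 = tail l' k' m.+1).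

Let good_mul g d : good g -> vanishing d -> vanishing (d ** g).
Proof.
move=> hg hd l k; apply: null_seqS.
apply: (@eq_null_seq _ _ (fun m => p v ** (d ** (g ** tail l k m.+1)))) => [m|].
  by rewrite -(amulA d).
have [h|[l' [k' [h|h]]]] := hg l k.
- by apply: eq_null_seq (@null_seq0 _ A) => m; rewrite h !amul0r.
- by apply: eq_null_seq (hd l' k') => m; rewrite h.
- apply: (@eq_null_seq _ _ (fun m => p v ** (d ** tail l' k' m.+1))) => [m|].
    by rewrite h.
  by move=> e /(hd l' k')[N hN]; exists N => n Nn; exact/hN/leqW.
Qed.

Let good_vanishing g : good g -> vanishing g.
Proof.
move=> hg l k; apply: null_seqS.
apply: eq_null_seq (@null_seq0 _ A) => m.
have [h|[l' [k' [h|h]]]] := hg l k; rewrite h ?amul0r//.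
  exact: vertex_tail0.
exact: vertex_tail0.
Qed.

Let good_vertex u : good (p u).
Proof.
move=> l k; have [h|h] := vertex_tail u l k; first by left.
by right; exists l, k; right=> m.
Qed.

Let good_edge e : good (s e).
Proof. by move=> l k; right; exists (e :: l), k; right. Qed.

Let good_edge_star e : good (star (s e)).
Proof.
move=> [|f l] k.
  have [h|h] := xi_shift k e; first by left.
  by right; exists [::], k.+1; left.
have [->|h] := pselect (e = f); last first.
  by left=> m; rewrite /= amulA (edge_orth hE hCK)// amul0l.
have [h|h] := vertex_tail (src f) l k.
  by left=> m; rewrite /= amulA (family_iso hCK); exact: h.
by right; exists l, k; right=> m; rewrite /= amulA (family_iso hCK); exact: h.
Qed.

(** The right multipliers of [vanishing] that lie in it together with their
    adjoints form a C*-subalgebra containing the generators.  It is necessary to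
    carry the membership along because A need not have a unit. *)
Let all_vanishing a : vanishing a.
Proof.
pose mult a := vanishing a /\ forall d, vanishing d -> vanishing (d ** a).
suff : [set a | mult a /\ mult (star a)] a by move=> [[]].
have : family_cstar p s a by rewrite hgen.
apply: cstar_gen_sub; last first.
  move=> _ [[u _ <-]|[e _ <-]]; split.
  - by split=> [|d]; [apply: good_vanishing|apply: good_mul]; exact: good_vertex.
  - rewrite (family_star hCK).
    by split=> [|d]; [apply: good_vanishing|apply: good_mul]; exact: good_vertex.
  - by split=> [|d]; [apply: good_vanishing|apply: good_mul]; exact: good_edge.
  - by split=> [|d]; [apply: good_vanishing|apply: good_mul]; exact: good_edge_star.
have multD (c : R[i]) x y : mult x -> mult y -> mult (c *: x + y).
  move=> [h1 h2] [h3 h4]; split; first exact: vanishingD.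
  by move=> d hd; rewrite amulDr amulZr; apply: vanishingD; [exact: h2|exact: h4].
have multM x y : mult x -> mult y -> mult (x ** y).
  move=> [h1 h2] [h3 h4]; split; first exact: h4.
  by move=> d hd; rewrite amulA; apply/h4/h2.
have mult_closed : closed mult.
  apply/closed_limP => x hx; split.
    have /closed_limP := vanishing_closed; apply => e /hx[y [hy _] xy].
    by exists y.
  move=> d hd.
  have : closed [set x | vanishing (d ** x)].
    by apply: (closed_lipschitz vanishing_closed (amull_lip d)).
  by move=> /closed_limP; apply => e /hx[y [_ hy] xy]; exists y => //; exact: hy.
split.
- apply: (@closedI _ mult [set x | mult (star x)]) => //.
  exact: (closed_lipschitz mult_closed (@star_lip _ A)).
- have m0 : mult 0 by split=> [|d _]; rewrite ?amul0r; exact: vanishing0.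
  by split; rewrite ?star0.
- by move=> c x y [x1 x2] [y1 y2]; split; rewrite ?starD ?starZ; exact: multD.
- by move=> x y [x1 x2] [y1 y2]; split; rewrite ?starM; exact: multM.
- by move=> x [x1 x2]; split; rewrite ?starK.
Qed.

(** I consists of the a that annihilate, in the limit, all the vectors generated
    by the tails of x.  It is proper because xi has norm 1. *)
Lemma tail_ideal : exists I : set A, [/\ closed_ideal I, I (p v) & I <> setT].
Proof.
pose I := [set a | forall c, null_seq (fun m => a ** (c ** xi 0 m))].
exists I; split.
- split.
  + apply/closed_limP => a ha c.
    suff : closed [set a | null_seq (fun m => a ** (c ** xi 0 m))].
      by move=> /closed_limP; apply => e /ha[b hb ab]; exists b => //; exact: hb.
    apply: (@null_seq_closed _ _ _ (nr c)) => x y n.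
    rewrite -amulBl mulrC; apply: le_trans (nrM _ _) _.
    apply: ler_wpM2l; first exact: nr_ge0.
    by apply: le_trans (nrM _ _) _; rewrite nr_xi mulr1.
  + by move=> c e e0; exists 0%N => n _; rewrite amul0l nr0.
  + move=> z a b ha hb c.
    apply: (@eq_null_seq _ _ (fun m => z *: (a ** (c ** xi 0 m)) +
        b ** (c ** xi 0 m))) => [m|]; first by rewrite amulDl amulZl.
    by apply: null_seqD; [apply: null_seqZ; exact: ha|exact: hb].
  + move=> a b ha; split=> c.
      by apply: eq_null_seq (ha (b ** c)) => m; rewrite -!amulA.
    by apply: eq_null_seq (null_seqMl b (ha c)) => m; rewrite -amulA.
- by move=> c; exact: (all_vanishing c [::] 0%N).
- move=> IT; have : I (p (xv 0)) by rewrite IT.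
  move=> /(_ (p (xv 0)) 1 ltr01)[N /(_ N (leqnn _))].
  by rewrite !xi_rng nr_xi ltxx.
Qed.

End TailIdeal.

(** * Cutting sets *)

Section CuttingSet.
Variable E : digraph.
Implicit Types (e f g : edge E) (l r mu nu : seq (edge E)).

Lemma mem_cyclic_class mu e : class_edges (cyclic_class mu) e <-> e \in mu.
Proof.
split=> [[_ [k ->]]|h]; first by rewrite mem_rot.
by exists mu => //; exists 0%N; rewrite rot0.
Qed.

Lemma cyclic_class_rot i mu : cyclic_class (rot i mu) = cyclic_class mu.
Proof.
have sub j l : cyclic_class (rot j l) `<=` cyclic_class l.
  move=> _ [k ->]; rewrite (rot_minn j) (rot_minn k) size_rot.
  by rewrite rot_add_mod ?geq_minr//; eexists; reflexivity.
apply/seteqP; split; first exact: sub.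
by rewrite -{1}(rotK i mu); exact: sub.
Qed.

Lemma is_cycle_rot i mu : is_cycle mu -> is_cycle (rot i mu).
Proof.
move=> /and3P[m0 mc mu1]; apply/and3P; split.
- by rewrite -size_eq0 size_rot size_eq0.
- by rewrite rot_cycle.
- by rewrite map_rot rot_uniq.
Qed.

Lemma no_entrance_rot i mu : no_entrance mu -> no_entrance (rot i mu).
Proof. by move=> h e f; rewrite mem_rot; exact: h. Qed.

(** Along a cycle without entrance, each edge determines the next one, since the
    next edge is the only one with its range. *)
Lemma entry_free_prefix e l l' :
  path (@composable E) e l -> path (@composable E) e l' ->
  (forall f g, f \in l -> rng f = rng g -> f = g) ->
  (exists r, l' = l ++ r) \/ (exists r, l = l' ++ r).
Proof.
elim: l e l' => [|f l IH] e [|g l'] /=; try by left; exists [::].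
- by left; exists (g :: l').
- by right; exists (f :: l).
move=> /andP[/eqP ef fl] /andP[/eqP eg gl] h.
have fg : f = g by apply: h; rewrite ?mem_head// -ef.
rewrite -fg in gl *.
have [|[r ->]|[r ->]] := IH f l' fl gl.
- by move=> f' g' hf; apply: h; rewrite inE hf orbT.
- by left; exists r.
- by right; exists r.
Qed.

(** When the cycle e l closes up, a longer path has to continue with e, and then
    repeats an edge. *)
Lemma entry_free_wrap e l r : cycle (@composable E) (e :: l) ->
  (forall g, rng e = rng g -> e = g) -> path (@composable E) e (l ++ r) ->
  uniq (e :: l ++ r) -> r = [::].
Proof.
case: r => [|g r] //=; rewrite rcons_path cat_path /=.
move=> /andP[_ /eqP h1] h /andP[_ /andP[/eqP h2 _]] /andP[].
by rewrite -(h g) ?mem_cat ?mem_head ?orbT// -h1.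
Qed.

(** Distinct classes of cycles without entrance have no edge in common, which
    makes one choice of an edge per class a cutting set. *)
Lemma entry_free_class_eq mu nu e : is_cycle mu -> no_entrance mu ->
  is_cycle nu -> no_entrance nu -> e \in mu -> e \in nu ->
  cyclic_class mu = cyclic_class nu.
Proof.
move=> cm nm cn nn em en.
have [i l hl] := rot_to em; have [j l' hl'] := rot_to en.
rewrite -(cyclic_class_rot i mu) -(cyclic_class_rot j nu) hl hl'.
have /and3P[_ c1 u1] : is_cycle (e :: l) by rewrite -hl; exact: is_cycle_rot.
have /and3P[_ c2 u2] : is_cycle (e :: l') by rewrite -hl'; exact: is_cycle_rot.
have n1 : no_entrance (e :: l) by rewrite -hl; exact: no_entrance_rot.
have he g : rng e = rng g -> e = g 
  := fun h => esym (n1 g e (mem_head _ _) (esym h)).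
have p1 : path (@composable E) e l by move: c1; rewrite /= rcons_path => /andP[].
have p2 : path (@composable E) e l' by move: c2; rewrite /= rcons_path => /andP[].
have [|[r hr]|[r hr]] := entry_free_prefix p1 p2.
- by move=> f g fl /esym h; apply/esym/n1 => //; rewrite inE fl orbT.
- rewrite hr in p2 u2 *.
  by rewrite (entry_free_wrap c1 he p2 (map_uniq u2)) cats0.
- rewrite hr in p1 u1 *.
  by rewrite (entry_free_wrap c2 he p1 (map_uniq u1)) cats0.
Qed.

Let rank : edge E -> nat := @choice.pickle (edge E).

Lemma cutting_set_exists : exists X : set (edge E), cutting_set X.
Proof.
exists [set e | exists2 C, entry_free_classes C &
  class_edges C e /\ forall f, class_edges C f -> (rank e <= rank f)%N].
split=> [e [C hC [Ce _]]|C hC]; first by exists C.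
have [mu [cm nm Cmu]] := hC.
have [e0 e0m] : exists e0, e0 \in mu.
  by case: mu cm {nm Cmu} => [|e0 mu] // _; exists e0; rewrite mem_head.
pose P n := `[< exists2 f, class_edges C f & rank f = n >].
have exP : exists n, P n.
  exists (rank e0); apply/asboolP; exists e0 => //.
  by rewrite Cmu; apply/mem_cyclic_class.
case: (ex_minnP exP) => n /asboolP[e Ce en] emin.
have emin' f : class_edges C f -> (rank e <= rank f)%N.
  by move=> Cf; rewrite en; apply: emin; apply/asboolP; exists f.
exists e; apply/seteqP; split=> [x [[C' hC' [C'x xmin]] Cx]|x ->]; last first.
  by split=> //; exists C.
have CC' : C = C'.
  have [nu [cn nn Cnu]] := hC'.
  rewrite Cmu Cnu; apply: (@entry_free_class_eq _ _ x) => //.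
    by apply/mem_cyclic_class; rewrite -Cmu.
  by apply/mem_cyclic_class; rewrite -Cnu.
rewrite -CC' in xmin.
have : rank x = rank e by apply/eqP; rewrite eqn_leq xmin// emin'.
exact: (pcan_inj (@choice.pickleK (edge E))).
Qed.

End CuttingSet.

(** * Simplicity implies cofinality *)
Section Necessity.
Variables (R : realType) (E : digraph) (A : cstarType R).
Variables (p : vertex E -> A) (s : edge E -> A).
Hypotheses (hE : row_finite E) (hCK : CK_family p s).
Hypotheses (hgen : family_cstar p s = setT) (hp : forall v, p v <> 0).

(** s_{y_k ... y_{k+m-1}}, with the vertex projection as the empty product. *)
Fixpoint path_tail (y : nat -> edge E) (k m : nat) : A :=
  if m is m'.+1 then s (y k) ** path_tail y k.+1 m' else p (rng (y k)).

Lemma proper_ideal_of_unreached v (x : bpath E) : is_bpath x ->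
  (forall n, le_length n x -> ~ connects v (nth_vertex x n)) ->
  exists I : set A, [/\ closed_ideal I, I (p v) & I <> setT].
Proof.
case: x => [w l [hl src0]|y hy] hv.
- pose u := path_src w l.
  have nu : ~ connects v u.
    have := hv (size l) (leqnn _); rewrite /= -(size_map (@src E)).
    by rewrite -last_nth.
  apply: (@tail_ideal _ _ _ _ _ hE hCK hgen hp (fun=> u) (fun _ _ => p u)) => //.
  + by move=> _ _; rewrite (family_idem hCK).
  + move=> _ e; left=> _.
    rewrite -(family_star hCK) -starM -(edge_rng hE hCK) amulA.
    rewrite (family_orth hCK) ?amul0l ?star0// => h.
    have : edges_to u e by [].
    by rewrite /u src0.
  + by move=> _ _; exact: (nr_vertex hCK (@hp _)).
- have hs k : src (y k) = rng (y k.+1) by apply/eqP; exact: hy.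
  have rngE k m : p (rng (y k)) ** path_tail y k m = path_tail y k m.
    by case: m => [|m] /=; rewrite ?(family_idem hCK)// amulA (edge_rng hE hCK).
  apply: (@tail_ideal _ _ _ _ _ hE hCK hgen hp (fun k => rng (y k))
    (path_tail y)) => //.
  + move=> k e; have [->|h] := pselect (e = y k).
      by right=> m; rewrite /= amulA (family_iso hCK) hs.
    by left=> m; rewrite /= amulA (edge_orth hE hCK)// amul0l.
  + move=> k m; elim: m k => [|m IH] k /=; first exact: (nr_vertex hCK (@hp _)).
    apply/eqP; rewrite -(@eqrXn2 _ 2) ?nr_ge0// -nr_sqr starM amulA.
    rewrite -(amulA (star _)) (family_iso hCK) hs -amulA rngE nr_sqr.
    by rewrite IH.
  + by move=> [|k]; [exact: (hv 0%N)|rewrite -hs; exact: (hv k.+1)].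
Qed.

Lemma cofinal_of_simple : simple_cstar A -> cofinal E.
Proof.
move=> hA v x hx; apply: contrapT => h.
have [n xn vn|I [hI Iv IT]] := @proper_ideal_of_unreached v x hx.
  by apply: h; exists n.
have [I0|//] := hA I hI.
by move: Iv; rewrite I0 => /(@hp _).
Qed.

End Necessity.

(** * Cofinality implies simplicity *)
Section VertexIdeals.
Variables (R : realType) (E : digraph) (A : cstarType R).
Variables (p : vertex E -> A) (s : edge E -> A).
Hypotheses (hE : row_finite E) (hCK : CK_family p s).
Variables (I : set A) (hI : closed_ideal I).

Lemma vertex_ideal_hereditary v w : connects v w -> I (p v) -> I (p w).
Proof.
move=> [l]; elim: l v => [|e l IH] v /=; first by move=> _ <-.
move=> /andP[/eqP <- hl] hw Ie; apply: (IH (src e)) => //.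
- by case: l hl {hw IH} => [|f l] //= /andP[/eqP -> ->]; rewrite eqxx.
- rewrite -(family_iso hCK); apply: ideal_mull => //.
  by rewrite -(edge_rng hE hCK); exact: ideal_mulr.
Qed.

Lemma vertex_ideal_saturated v : edges_to v !=set0 ->
  (forall e, rng e = v -> I (p (src e))) -> I (p v).
Proof.
move=> [e0 <-] h; rewrite (vertex_sum hE hCK) big_seq.
apply: (big_ind I) => [|a b Ia Ib|e]; first exact: ideal0.
  exact: idealD.
rewrite (in_fset_set (hE _)) => /set_mem /h Ie.
by rewrite -(edge_src hCK); apply: (ideal_mulr hI); apply: (ideal_mull hI).
Qed.

(** If p_w is not in I, a boundary path avoids the vertices of I altogether: either
    the path of length 0 at such a vertex that receives no edge, or the infinite
    path obtained by repeatedly choosing, by saturation, an edge whose source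
    is not in I.  Cofinality joins v to that path, against heredity. *)
Lemma vertex_ideal_full v : cofinal E -> I (p v) -> forall w, I (p w).
Proof.
move=> hc Iv w; apply: contrapT => Iw.
have [[u Iu u0]|h] := pselect (exists2 u, ~ I (p u) & edges_to u = set0).
  have [|n n0 /vertex_ideal_hereditary /(_ Iv)] := hc v (FinPath u [::]).
    by [].
  by move: n0; rewrite /= leqn0 => /eqP ->.
have next u : ~ I (p u) -> exists e, rng e = u /\ ~ I (p (src e)).
  move=> Iu; apply: contrapT => hu; apply: (Iu).
  apply: vertex_ideal_saturated.
    by apply/set0P/eqP => u0; apply: h; exists u.
  by move=> e eu; apply: contrapT => Ie; apply: hu; exists e.
have [e0 _] := next w Iw.
have [g hg] : {g : vertex E -> edge E & forall u,
    ~ I (p u) -> rng (g u) = u /\ ~ I (p (src (g u)))}.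
  apply: (@boolp.choice _ _ (fun u e => ~ I (p u) ->
    rng e = u /\ ~ I (p (src e)))) => u.
  have [Iu|/next[e he]] := pselect (I (p u)); first by exists e0.
  by exists e.
pose V n := iter n (fun u => src (g u)) w.
have IV n : ~ I (p (V n)) by elim: n => [//|n IH]; exact: (hg _ IH).2.
have [|n _] := hc v (InfPath (fun n => g (V n))).
  by move=> n; apply/eqP; rewrite -[src _]/(V n.+1) (hg _ (IV n.+1)).1.
have -> : nth_vertex (InfPath (fun n => g (V n))) n = V n.
  by case: n => [|n] //=; exact: (hg _ (IV 0%N)).1.
by move=> /vertex_ideal_hereditary /(_ Iv); exact: IV.
Qed.

Lemma ideal_full : family_cstar p s = setT -> (forall v, I (p v)) -> I = setT.
Proof.
move=> hgen hv; apply/seteqP; split=> // a _.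
have : family_cstar p s a by rewrite hgen.
apply: cstar_gen_sub => [|_ [[v _ <-]|[e _ <-]]]; first split.
- exact: ideal_closed.
- exact: ideal0.
- by move=> c x y Ix Iy; apply: idealD => //; exact: idealZ.
- by move=> x y Ix _; exact: ideal_mulr.
- by move=> x; exact: ideal_star.
- exact: hv.
- by rewrite -(edge_rng hE hCK); exact: ideal_mulr.
Qed.

End VertexIdeals.

Section Uniqueness.
Variables (R : realType) (E : digraph) (A : cstarType R).
Variables (p : vertex E -> A) (s : edge E -> A).
Hypothesis hA : is_cstar_min p s.
Variables (I : set A) (hI : closed_ideal I).
Hypothesis Ip : forall v, ~ I (p v).

Let hCK : CK_family p s. Proof. by case: hA => -[]. Qed.
Let B := cstar_quotient hI.
Let q v : B := cls hI (p v).
Let t e : B := cls hI (s e).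

Let quotient_TCK : TCK_family q t.
Proof.
have [[h1 h2 h3 h4] _] := hCK; split.
- by move=> v; split; rewrite -?clsM -?cls_starE ?(family_idem hCK) ?(family_star hCK).
- by move=> v w vw; rewrite -clsM h2// cls0.
- by move=> e; rewrite -cls_starE -clsM h3.
- move=> v F finF Fv; have [c hc] := h4 v F finF Fv.
  exists (cls hI c); rewrite -cls_starE -clsM -hc clsB; congr (_ - _).
  rewrite !fsbig_finite// (big_morph _ (@clsD _ _ _ hI) (@cls0 _ _ _ hI)).
  by apply: eq_bigr => e _; rewrite clsM cls_starE.
Qed.

Let quotient_nonzero v : q v <> 0.
Proof. by move=> /cls_eq0; exact: Ip. Qed.

(** psi is a left inverse of the quotient map on the generators, provided that
    kappa is 1.  For x in X, let mu = x l be the cycle without entrance through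
    x; it has no other edge in X, so psi maps the class of s_mu to
    kappa(x) s_mu, while s_mu = p_{r(x)} is fixed.  Contractivity of psi extends
    the equation to the closure of the algebra generated. *)
Lemma ideal_trivial_of_no_vertex : I = [set 0].
Proof.
have [hN hgen hp huniv] := hA.
have [X hX] := cutting_set_exists E.
have [kappa [psi [_ hpsi psip psis psix]]] :=
  huniv B q t X quotient_TCK quotient_nonzero hX.
set D := family_cstar q t in hpsi.
have hD : cstar_subalgebra D := cstar_gen_subalgebra _.
have Dq v : D (q v) by apply: cstar_gen_incl; left; exists v.
have Dt e : D (t e) by apply: cstar_gen_incl; right; exists e.
have kappa1 x : X x -> kappa x = 1.
  move=> Xx; have [C hC Cx] := hX.1 x Xx.
  have [mu [cm nm Cmu]] := hC.
  have [e Xe] := hX.2 C hC.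
  have xe y : X y -> class_edges C y -> y = e.
    by move=> Xy Cy; have : (X `&` class_edges C) y by []; rewrite Xe.
  have xmu : x \in mu by apply/mem_cyclic_class; rewrite -Cmu.
  have [i l hl] := rot_to xmu.
  have cl : is_cycle (x :: l) by rewrite -hl; exact: is_cycle_rot.
  have nl : no_entrance (x :: l) by rewrite -hl; exact: no_entrance_rot.
  have lX f : f \in l -> ~ X f.
    move=> fl Xf; have fx : f = x.
      rewrite (xe x Xx Cx); apply: xe => //; rewrite Cmu; apply/mem_cyclic_class.
      by rewrite -(mem_rot i) hl inE fl orbT.
    by have /and3P[_ _ /map_uniq /=] := cl; rewrite -fx fl.
  have key : D (path_elt t x l) /\
      psi (path_elt t x l) = kappa x *: path_elt s x l /\
      path_elt t x l = cls hI (path_elt s x l).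
    elim/last_ind: l lX {hl cl nl} => [|l f IH] lX.
      by split; [exact: Dt|split; [exact: psix|]].
    have lX' g : g \in l -> ~ X g.
      by move=> gl; apply: lX; rewrite mem_rcons inE gl orbT.
    have [IH1 [IH2 IH3]] := IH lX'.
    have e1 (T : cstarType R) (r : edge E -> T) :
        path_elt r x (rcons l f) = path_elt r x l ** r f.
      by rewrite /path_elt foldl_rcons.
    rewrite !e1; split; first exact: (subalgM hD IH1 (Dt f)).
    split; last by rewrite IH3 clsM.
    rewrite (homM hpsi)// IH2 amulZl psis//.
    by apply: lX; rewrite mem_rcons mem_head.
  have [_ [k1 k2]] := key; have ps := hN.2 x l cl nl.
  rewrite k2 ps -/(q _) psip in k1.
  apply/eqP; rewrite eq_sym -subr_eq0; apply/contraT => k0.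
  have : (1 - kappa x) *: p (rng x) == 0 by rewrite scalerBl scale1r -k1 subrr.
  by rewrite scaler_eq0 (negbTE k0) /= => /eqP /hp.
have psit e : psi (t e) = s e.
  have [Xe|Xe] := pselect (X e); last exact: psis.
  by rewrite psix// kappa1// scale1r.
have lift a : D (cls hI a : B) /\ psi (cls hI a) = a.
  pose S := [set a | D (cls hI a : B) /\ psi (cls hI a) = a].
  suff : S a by [].
  have : family_cstar p s a by rewrite hgen.
  apply: cstar_gen_sub => [|_ [[v _ <-]|[e _ <-]]]; last 2 first.
  - by split; [exact: Dq|exact: psip].
  - by split; [exact: Dt|exact: psit].
  split.
  - have cD : closed [set a | D (cls hI a : B)].
      apply: (@closed_lipschitz R A B (cls hI) 1 D (star_subalg_closed hD)) => x y.
      by rewrite -clsB mul1r; exact: nr_cls.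
    apply/closed_limP => l hl.
    have Dl : D (cls hI l : B).
      by move/closed_limP : cD; apply => e /hl[x [Dx _] lx]; exists x.
    split=> //; apply/eqP; rewrite -subr_eq0; apply/eqP/nr0_eq0/eqP.
    rewrite eq_le nr_ge0 andbT; apply/ler_addgt0Pr => e e0.
    have [|x [Dx px] lx] := hl (e / 2); first by rewrite divr_gt0.
    have h1 : nr (psi (cls hI l) - x) <= nr (l - x).
      rewrite -{1}px -(homB hD hpsi)// -clsB.
      apply: le_trans (hom_contractive hD hpsi _) (nr_cls hI _).
      by rewrite clsB; exact: (subalgB hD).
    rewrite add0r (splitr e); apply: le_trans (nr_tri _ x _) _.
    by apply: lerD; [exact: (le_trans h1 (ltW lx))|rewrite nrB ltW].
  - by rewrite /S /= cls0; split; [exact: (subalg0 hD)|exact: hom0 hpsi].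
  - move=> c x y [Dx px] [Dy py]; rewrite /S /= clsD clsZ; split.
      by apply: (subalgD hD) => //; exact: (subalgZ hD).
    by rewrite (homD hpsi)// ?(homZ hD hpsi)// ?px ?py//; exact: (subalgZ hD).
  - move=> x y [Dx px] [Dy py]; rewrite /S /= clsM; split; first exact: (subalgM hD).
    by rewrite (homM hpsi)// px py.
  - move=> x [Dx px]; rewrite /S /= cls_starE; split; first exact: (subalg_star hD).
    by rewrite (hom_star hpsi)// px.
apply/seteqP; split=> [a Ia|_ ->]; last exact: ideal0.
rewrite /= -(lift a).2 (_ : cls hI a = 0); first exact: hom0 hD hpsi.
exact/cls_eq0.
Qed.

End Uniqueness.

Theorem corollary4p4 (R : realType) (E : digraph) (hE : row_finite E)
    (A : cstarType R) (p : vertex E -> A) (s : edge E -> A)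
    (hA : is_cstar_min p s) :
  simple_cstar A <-> cofinal E.
Proof.
have [[hCK _] hgen hp _] := hA; split; first exact: cofinal_of_simple hgen hp.
move=> hc I hI; have [[v Iv]|h] := pselect (exists v, I (p v)).
  right; apply: (ideal_full hE hCK hI hgen).
  exact: (vertex_ideal_full hE hCK hI hc Iv).
left; apply: (ideal_trivial_of_no_vertex hA hI) => v Iv.
by apply: h; exists v.
Qed.
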